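(* Let $\mathbf{A}$ be a weakly Mal'tsev category with a $V$-Mal'tsev operation $p$, where $V\colon\mathbf{A}\to\mathbf{B}$ is faithful and preserves finite limits ($\mathbf{A},\mathbf{B}$ with finite limits). An internal homogeneous pseudocategory in $\mathsf{Grpd}(\mathbf{A})\cong\mathsf{G}(\mathbf{A})^{*}$ is completely determined by a diagram in $\mathsf{G}(\mathbf{A})^{*}$ of the form $$d,c\colon C_1\rightrightarrows C_0,\qquad e\colon C_0\to C_1,$$ together with 2-cells $\lambda,\rho\in H(C_1,C_1)$ such that $$de=1_{C_0}=ce,\quad d\lambda=d=d\rho,\quad c\lambda=c=c\rho,\quad \lambda e=e=\rho e,\quad \mathrm{cod}(\lambda)=1_{C_1}=\mathrm{cod}(\rho),$$ and such that moreover: - there exists a (unique) morphism $m\colon C_1\times_{C_0}C_1\to C_1$ in $\mathsf{G}(\mathbf{A})^{*}$ with $$V(m)=p_{C_1}\langle V(\mathrm{dom}(\rho)\pi_1),V(ed\pi_1),V(\mathrm{dom}(\lambda)\pi_2)\rangle;$$ - there exists a (unique) 2-cell $\alpha\in H(C_1\times_{C_0}(C_1\times_{C_0}C_1),C_1)$ with $$V(\alpha)=p_{C_1}\big\langle V(\alpha_1\pi_1),V(0_e d\pi_1),p_{C_1}\langle V(\alpha_2\pi_2),V(0_e d\pi_2),V(\alpha_3\pi_3)\rangle\big\rangle,$$ where $\alpha_1,\alpha_2,\alpha_3\in H(C_1,C_1)$ are $$\alpha_1=-\rho\,\mathrm{dom}(\rho),\qquad \alpha_2=-\mathrm{dom}(\rho)\lambda+\lambda\,\mathrm{dom}(\rho),\qquad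 \alpha_3=\lambda\,\mathrm{dom}(\lambda).$$ That is: in every homogeneous pseudocategory $(C_0,C_1,d,c,e,m,\alpha,\lambda,\rho)$ in $\mathsf{G}(\mathbf{A})^{*}$ one has $de=1_{C_0}=ce$, $d\lambda=d=d\rho$, $c\lambda=c=c\rho$, $\lambda e=e=\rho e$, $\mathrm{cod}(\lambda)=1_{C_1}=\mathrm{cod}(\rho)$, and $m$ and $\alpha$ satisfy $V(m)=p_{C_1}\langle V(\mathrm{dom}(\rho)\pi_1),V(ed\pi_1),V(\mathrm{dom}(\lambda)\pi_2)\rangle$ and $V(\alpha)=p_{C_1}\langle V(\alpha_1\pi_1),V(0_e d\pi_1),p_{C_1}\langle V(\alpha_2\pi_2),V(0_e d\pi_2),V(\alpha_3\pi_3)\rangle\rangle$ with $\alpha_1=-\rho\,\mathrm{dom}(\rho)$, $\alpha_2=-\mathrm{dom}(\rho)\lambda+\lambda\,\mathrm{dom}(\rho)$, $\alpha_3=\lambda\,\mathrm{dom}(\lambda)$; and conversely, for every diagram $d,c\colon C_1\rightrightarrows C_0$, $e\colon C_0\to C_1$ in $\mathsf{G}(\mathbf{A})^{*}$ with 2-cells $\lambda,\rho\in H(C_1,C_1)$ satisfying $de=1_{C_0}=ce$, $d\lambda=d=d\rho$, $c\lambda=c=c\rho$, $\lambda e=e=\rho e$, $\mathrm{cod}(\lambda)=1_{C_1}=\mathrm{cod}(\rho)$, and for which there exist a morphism $m\colon C_1\times_{C_0}C_1\to C_1$ in $\mathsf{G}(\mathbf{A})^{*}$ and a 2-cell $\alpha\in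 H(C_1\times_{C_0}(C_1\times_{C_0}C_1),C_1)$ whose images $V(m)$ and $V(\alpha)$ are given by these same two formulas, $(C_0,C_1,d,c,e,m,\alpha,\lambda,\rho)$ is a homogeneous pseudocategory.
   Context: **$V$-Mal'tsev operation.** A natural transformation $p\colon V^3\to V$ with $p_A\langle x,y,y\rangle=x=p_A\langle y,y,x\rangle$ for all $x,y\colon B\to V(A)$ in $\mathbf{B}$. A category with finite limits is weakly Mal'tsev if for all split epimorphisms $f\colon A\to B$, $g\colon C\to B$ with sections $r$, $s$ the morphisms $\langle1_A,sf\rangle$, $\langle rg,1_C\rangle$ into $A\times_BC$ are jointly epimorphic (this holds automatically here). **The category $\mathsf{G}(\mathbf{A})^{*}$.** Objects: triples $(A,s,t)$ with $A$ in $\mathbf{A}$ and $s,t\colon A\to A$ with $st=t$, $ts=s$, satisfying (P1): for all $\alpha,\beta,\gamma\colon X\to A$ in $\mathbf{A}$ with $s\alpha=s\beta$, $t\beta=t\gamma$, there is a unique $\varphi\colon X\to A$ in $\mathbf{A}$ with $V(\varphi)=p_A\langle V\alpha,V\beta,V\gamma\rangle$. Morphisms $(A',s',t')\to(A,s,t)$: morphisms $f\colon A'\to A$ of $\mathbf{A}$ with $sf=fs'$, $tf=ft'$. It is equivalent to the category $\mathsf{Grpd}(\mathbf{A})$ of internal groupoids in $\mathbf{A}$, a groupoid with object of arrows $A$, domain $d$, codomain $c$ and identities $e$ corresponding to $(A,ed,ec)$. For an object $C=(A,s,t)$, $p_C$ and $V$ refer to the underlying object $A$ and underlying morphisms. **2-cells.**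 $H((A',s',t'),(A,s,t))$ is the set of morphisms $\tau\colon A'\to A$ of $\mathbf{A}$ with $s\tau s'=s\tau$ and $t\tau t'=t\tau$. Such $\tau$ is a 2-cell $\mathrm{dom}(\tau)\Rightarrow\mathrm{cod}(\tau)$, where $\mathrm{dom}(\tau),\mathrm{cod}(\tau)$ are the unique morphisms with $V(\mathrm{dom}(\tau))=p_A\langle V(s\tau t'),V(\tau t'),V(\tau)\rangle$ and $V(\mathrm{cod}(\tau))=p_A\langle V(\tau),V(\tau s'),V(t\tau s')\rangle$. The identity 2-cell on $f$ is $0_f=f$; if $\mathrm{dom}(\tau)=f=\mathrm{cod}(\sigma)$, the vertical composite $\tau+\sigma$ (first $\sigma$, then $\tau$) is the unique morphism with $V(\tau+\sigma)=p_A\langle V\tau,Vf,V\sigma\rangle$; the vertical inverse $-\tau$ is the unique morphism with $V(-\tau)=p_A\langle V(\mathrm{dom}(\tau)),V\tau,V(\mathrm{cod}(\tau))\rangle$. Whiskering of a 2-cell $\tau$ with morphisms $u,v$ is the composite $v\tau u$ in $\mathbf{A}$. This 2-category structure corresponds to internal natural transformations in $\mathsf{Grpd}(\mathbf{A})$. **Pseudocategories.** A pseudocategory in a 2-category consists of objects $C_0,C_1$, morphisms $d,c\colon C_1\to C_0$, $e\colon C_0\to C_1$ with $de=1=ce$, a morphism $m\colon C_1\times_{C_0}C_1\to C_1$ on the pullback of $d$ (first factor, projection $\pi_1$) and $c$ (second factor, projection $\pi_2$) with $dm=d\pi_2$, $cm=c\pi_1$, and invertible 2-cells $\alpha\colon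 m(1\times m)\Rightarrow m(m\times1)$, $\lambda\colon me_2\Rightarrow1_{C_1}$, $\rho\colon me_1\Rightarrow1_{C_1}$, where $e_1=\langle1,ed\rangle$, $e_2=\langle ec,1\rangle$, such that $d\lambda=d=d\rho$, $c\lambda=c=c\rho$, $d\alpha=d\pi_3$, $c\alpha=c\pi_1$, $\lambda e=\rho e$ (identity 2-cells being written as the morphism), and satisfying the pentagon $\alpha(m\times1\times1)\cdot\alpha(1\times1\times m)=m(\alpha\times1)\cdot\alpha(1\times m\times1)\cdot m(1\times\alpha)$ and triangle $m(\rho\times1)\cdot\alpha\langle\pi_1,ed\pi_1,\pi_2\rangle=m(1\times\lambda)$. It is homogeneous if moreover $\lambda e=e=\rho e$. On $C_1\times_{C_0}(C_1\times_{C_0}C_1)$ the projections are $\pi_1,\pi_2,\pi_3$. *)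

(* Defs.v *)
From mathcomp Require Import ssreflect ssrfun ssrbool.
From Stdlib Require Import List FinFun Classical_Prop ClassicalEpsilon.

Set Implicit Arguments.
Unset Strict Implicit.
Unset Printing Implicit Defensive.

Declare Scope cat_scope.
Delimit Scope cat_scope with cat.
Local Open Scope cat_scope.

Record category := Category {
  ob :> Type;
  hom : ob -> ob -> Type;
  idm : forall X, hom X X;
  comp : forall X Y Z, hom Y Z -> hom X Y -> hom X Z;
  comp1m : forall X Y (f : hom X Y), comp (idm Y) f = f;
  compm1 : forall X Y (f : hom X Y), comp f (idm X) = f;
  compA : forall W X Y Z (h : hom Y Z) (g : hom X Y) (f : hom W X),
    comp h (comp g f) = comp (comp h g) f }.

Arguments hom {c} X Y.
Arguments idm {c} X.
Arguments comp {c X Y Z} g f.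
Notation "g ∘ f" := (comp g f) (at level 40, left associativity) : cat_scope.

Record functor (A B : category) := Functor {
  fob :> A -> B;
  fmap : forall X Y, hom X Y -> hom (fob X) (fob Y);
  fmap1 : forall X, fmap (idm X) = idm (fob X);
  fmapM : forall X Y Z (g : hom Y Z) (f : hom X Y),
    fmap (g ∘ f) = fmap g ∘ fmap f }.

Arguments fmap {A B} F {X Y} f : rename.

Section FunctorComp.
Context (A B C : category) (G : functor B C) (F : functor A B).

Lemma functor_comp1 (X : A) : fmap G (fmap F (idm X)) = idm (G (F X)).
Proof. by rewrite !fmap1. Qed.

Lemma functor_compM (X Y Z : A) (g : hom Y Z) (f : hom X Y) :
  fmap G (fmap F (g ∘ f)) = fmap G (fmap F g) ∘ fmap G (fmap F f).
Proof. by rewrite !fmapM. Qed.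

Definition functor_comp : functor A C :=
  {| fob := fun X => G (F X); fmap := fun X Y f => fmap G (fmap F f);
     fmap1 := functor_comp1; fmapM := functor_compM |}.

End FunctorComp.

Definition faithful (A B : category) (V : functor A B) : Prop :=
  forall X Y (f g : hom X Y), fmap V f = fmap V g -> f = g.

Record nat_trans (A B : category) (F G : functor A B) := NatTrans {
  component :> forall X : A, hom (F X) (G X);
  naturality : forall X Y (f : hom X Y),
    component Y ∘ fmap F f = fmap G f ∘ component X }.

Definition finite_category (J : category) : Prop :=
  Finite J /\ forall i j : J, Finite (hom i j).

Record cone (J A : category) (D : functor J A) := Cone {
  apex : A;
  leg : forall j, hom apex (D j);
  leg_nat : forall i j (u : hom i j), fmap D u ∘ leg i = leg j }.

Definition is_limit (J A : category) (D : functor J A) (L : cone D) : Prop :=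
  forall M : cone D, exists! u : hom (apex M) (apex L),
    forall j, leg L j ∘ u = leg M j.

Section MapCone.
Context (J A B : category) (V : functor A B) (D : functor J A) (L : cone D).

Lemma map_cone_nat (i j : J) (u : hom i j) :
  fmap V (fmap D u) ∘ fmap V (leg L i) = fmap V (leg L j).
Proof. by rewrite -fmapM leg_nat. Qed.

Definition map_cone : cone (functor_comp V D) :=
  @Cone _ _ (functor_comp V D) (V (apex L)) (fun j => fmap V (leg L j))
    map_cone_nat.

End MapCone.

Definition has_finite_limits (A : category) : Prop :=
  forall J : category, finite_category J ->
  forall D : functor J A, exists L : cone D, is_limit L.

Definition preserves_finite_limits (A B : category) (V : functor A B) : Prop :=
  forall J : category, finite_category J ->
  forall (D : functor J A) (L : cone D), is_limit L -> is_limit (map_cone V L).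

Lemma Finite_prop (P : Prop) : Finite P.
Proof.
case: (classic P) => [h|h]; last by exists nil => x; case: (h x).
by exists (h :: nil) => x; left; apply: proof_irrelevance.
Qed.

Record pullback (A : category) (X Y Z : A) (f : hom X Z) (g : hom Y Z) :=
  Pullback {
  pb_ob :> A;
  pb1 : hom pb_ob X;
  pb2 : hom pb_ob Y;
  pb_comm : f ∘ pb1 = g ∘ pb2;
  pb_pair : forall W (u : hom W X) (v : hom W Y), f ∘ u = g ∘ v -> hom W pb_ob;
  pb_pair1 : forall W (u : hom W X) (v : hom W Y) (h : f ∘ u = g ∘ v),
    pb1 ∘ pb_pair h = u;
  pb_pair2 : forall W (u : hom W X) (v : hom W Y) (h : f ∘ u = g ∘ v),
    pb2 ∘ pb_pair h = v;
  pb_uniq : forall W (w w' : hom W pb_ob),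
    pb1 ∘ w = pb1 ∘ w' -> pb2 ∘ w = pb2 ∘ w' -> w = w' }.

Arguments pb1 {A X Y Z f g} P : rename.
Arguments pb2 {A X Y Z f g} P : rename.
Arguments pb_pair {A X Y Z f g} P {W u v} h : rename.
Arguments pb_pair1 {A X Y Z f g} P {W u v} h : rename.
Arguments pb_pair2 {A X Y Z f g} P {W u v} h : rename.
Arguments pb_uniq {A X Y Z f g} P {W w w'} _ _ : rename.

Inductive three := i0 | i1 | i2.

Lemma Finite_three : Finite three.
Proof. by exists (i0 :: i1 :: i2 :: nil); case=> /=; tauto. Qed.

Definition discrete_three : category :=
  {| ob := three; hom := fun i j => i = j;
     idm := fun i => eq_refl; comp := fun i j k v u => eq_trans u v;
     comp1m := fun i j u => proof_irrelevance _ _ _;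
     compm1 := fun i j u => proof_irrelevance _ _ _;
     compA := fun h i j k w v u => proof_irrelevance _ _ _ |}.

Lemma finite_discrete_three : finite_category discrete_three.
Proof. by split=> [|i j]; [exact: Finite_three | exact: (Finite_prop (i = j))]. Qed.

Definition cospan_le (i j : three) : bool :=
  match i, j with
  | i0, i0 | i1, i1 | _, i2 => true
  | _, _ => false
  end.

Lemma cospan_refl i : cospan_le i i = true. Proof. by case: i. Qed.

Lemma cospan_trans i j k :
  cospan_le j k = true -> cospan_le i j = true -> cospan_le i k = true.
Proof. by case: i j k => [] [] []. Qed.

Definition cospan_shape : category :=
  {| ob := three; hom := fun i j => cospan_le i j = true;
     idm := cospan_refl; comp := cospan_trans;
     comp1m := fun i j u => proof_irrelevance _ _ _;
     compm1 := fun i j u => proof_irrelevance _ _ _;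
     compA := fun h i j k w v u => proof_irrelevance _ _ _ |}.

Lemma finite_cospan_shape : finite_category cospan_shape.
Proof.
split=> [|i j]; [exact: Finite_three | exact: (Finite_prop (cospan_le i j = true))].
Qed.

Section Cospan.
Context (A : category) (X Y Z : A) (f : hom X Z) (g : hom Y Z).

Definition cospan_ob (i : three) : A :=
  match i with i0 => X | i1 => Y | i2 => Z end.

Definition cospan_map (i j : three) :
  cospan_le i j = true -> hom (cospan_ob i) (cospan_ob j) :=
  match i, j return cospan_le i j = true -> hom (cospan_ob i) (cospan_ob j) with
  | i0, i0 => fun _ => idm X
  | i1, i1 => fun _ => idm Y
  | i2, i2 => fun _ => idm Z
  | i0, i2 => fun _ => f
  | i1, i2 => fun _ => g
  | _, _ => fun h => False_rect _ (Bool.diff_false_true h)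
  end.

Definition cospan : functor cospan_shape A.
Proof.
refine (@Functor cospan_shape A cospan_ob cospan_map _ _).
- by case.
- by move=> [] [] [] // v u; rewrite /= ?comp1m ?compm1.
Defined.

Definition cospan_cone (W : A) (u : hom W X) (v : hom W Y) (h : f ∘ u = g ∘ v) :
  cone cospan.
Proof.
refine (@Cone _ _ cospan W
  (fun i => match i return hom W (cospan_ob i) with
            | i0 => u | i1 => v | i2 => f ∘ u end) _).
by move=> [] [] // ?; rewrite /= ?comp1m.
Defined.

Lemma cospan_limit_exists_unique (L : cone cospan) (limL : is_limit L)
  W (u : hom W X) (v : hom W Y) : f ∘ u = g ∘ v ->
  exists! w : hom W (apex L), leg L i0 ∘ w = u /\ leg L i1 ∘ w = v.
Proof.
move=> h; case: (limL (cospan_cone h)) => w [hw uw].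
exists w; split=> [|w' [h0 h1]].
  by split; [apply: (hw i0) | apply: (hw i1)].
apply: uw; case => //=.
by rewrite -(leg_nat L (eq_refl : hom (i0 : cospan_shape) i2)) /= -compA h0.
Qed.

Section CospanLimit.
Context (L : cone cospan) (limL : is_limit L).

Lemma cospan_comm : f ∘ leg L i0 = g ∘ leg L i1.
Proof.
rewrite (leg_nat L (eq_refl : hom (i0 : cospan_shape) i2)).
by rewrite -(leg_nat L (eq_refl : hom (i1 : cospan_shape) i2)).
Qed.

Definition cospan_pair W (u : hom W X) (v : hom W Y) (h : f ∘ u = g ∘ v) :
  hom W (apex L) :=
  proj1_sig (constructive_indefinite_description _
    (cospan_limit_exists_unique limL h)).

Lemma cospan_pair1 W (u : hom W X) (v : hom W Y) (h : f ∘ u = g ∘ v) :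
  leg L i0 ∘ cospan_pair h = u.
Proof.
by rewrite /cospan_pair; case: constructive_indefinite_description => w [[]].
Qed.

Lemma cospan_pair2 W (u : hom W X) (v : hom W Y) (h : f ∘ u = g ∘ v) :
  leg L i1 ∘ cospan_pair h = v.
Proof.
by rewrite /cospan_pair; case: constructive_indefinite_description => w [[]].
Qed.

Lemma cospan_uniq W (w w' : hom W (apex L)) :
  leg L i0 ∘ w = leg L i0 ∘ w' -> leg L i1 ∘ w = leg L i1 ∘ w' -> w = w'.
Proof.
move=> h0 h1.
have h : f ∘ (leg L i0 ∘ w) = g ∘ (leg L i1 ∘ w) by rewrite !compA cospan_comm.
case: (cospan_limit_exists_unique limL h) => w0 [_ uw].
by rewrite -(uw w) // (uw w').
Qed.

Definition pullback_of_limit : pullback f g :=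
  {| pb_ob := apex L; pb1 := leg L i0; pb2 := leg L i1; pb_comm := cospan_comm;
     pb_pair := cospan_pair; pb_pair1 := cospan_pair1; pb_pair2 := cospan_pair2;
     pb_uniq := cospan_uniq |}.

End CospanLimit.

End Cospan.

Definition lim_pullback (A : category) (limA : has_finite_limits A)
  (X Y Z : A) (f : hom X Z) (g : hom Y Z) : pullback f g :=
  let L := constructive_indefinite_description _
    (limA _ finite_cospan_shape (cospan f g)) in
  pullback_of_limit (proj2_sig L).

Lemma map_cospan_limit (A B : category) (V : functor A B)
  (X Y Z : A) (f : hom X Z) (g : hom Y Z) (L : cone (cospan f g)) :
  is_limit (map_cone V L) ->
  forall W (u : hom W (V X)) (v : hom W (V Y)), fmap V f ∘ u = fmap V g ∘ v ->
  exists! w : hom W (V (apex L)),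
    fmap V (leg L i0) ∘ w = u /\ fmap V (leg L i1) ∘ w = v.
Proof.
move=> limL W u v h.
have nat : forall i j (a : @hom cospan_shape i j),
  fmap (functor_comp V (cospan f g)) a ∘
    match i return hom W (V (cospan_ob X Y Z i)) with
    | i0 => u | i1 => v | i2 => fmap V f ∘ u end
  = match j return hom W (V (cospan_ob X Y Z j)) with
    | i0 => u | i1 => v | i2 => fmap V f ∘ u end.
  by move=> [] [] // ?; rewrite /= ?fmap1 ?comp1m.
case: (limL (Cone nat)) => w [hw uw].
exists w; split=> [|w' [h0 h1]].
  by split; [apply: (hw i0) | apply: (hw i1)].
apply: uw; case => //=.
rewrite -(leg_nat L (eq_refl : hom (i0 : cospan_shape) i2)) /=.
by rewrite fmapM -compA h0.
Qed.

Section PreservedPullback.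
Context (A B : category) (V : functor A B) (limA : has_finite_limits A)
  (presV : preserves_finite_limits V) (X Y Z : A) (f : hom X Z) (g : hom Y Z).

Let P := lim_pullback limA f g.

Lemma preserved_pair W (u : hom W (V X)) (v : hom W (V Y)) :
  fmap V f ∘ u = fmap V g ∘ v ->
  exists w : hom W (V P), fmap V (pb1 P) ∘ w = u /\ fmap V (pb2 P) ∘ w = v.
Proof.
rewrite /P /lim_pullback; case: constructive_indefinite_description => L limL h.
have [w [hw _]] := map_cospan_limit (presV finite_cospan_shape limL) h.
by exists w.
Qed.

Lemma preserved_uniq W (w w' : hom W (V P)) :
  fmap V (pb1 P) ∘ w = fmap V (pb1 P) ∘ w' ->
  fmap V (pb2 P) ∘ w = fmap V (pb2 P) ∘ w' -> w = w'.
Proof.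
have : fmap V f ∘ (fmap V (pb1 P) ∘ w) = fmap V g ∘ (fmap V (pb2 P) ∘ w).
  by rewrite !compA -!fmapM pb_comm.
rewrite /P /lim_pullback in w w' *.
case: constructive_indefinite_description w w' => L limL /= w w' h h0 h1.
have [w0 [_ uw]] := map_cospan_limit (presV finite_cospan_shape limL) h.
by rewrite -(uw w) // (uw w').
Qed.

End PreservedPullback.

Definition const_three (B : category) (b : B) : functor discrete_three B :=
  {| fob := fun _ : discrete_three => b; fmap := fun _ _ _ => idm b;
     fmap1 := fun _ => eq_refl; fmapM := fun _ _ _ _ _ => eq_sym (comp1m (idm b)) |}.

Section Cube.
Context (B : category) (limB : has_finite_limits B).

(* The third power is the limit of a constant diagram on three points; it is chosen
   arbitrarily, like every limit here. *)
Definition cube_limit (b : B) : { L : cone (const_three b) | is_limit L } :=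
  constructive_indefinite_description _
    (limB finite_discrete_three (const_three b)).

Definition cube (b : B) : B := apex (proj1_sig (cube_limit b)).

Definition cube_proj (b : B) (i : three) : hom (cube b) b :=
  leg (proj1_sig (cube_limit b)) i.

Lemma cube_exists_unique (b W : B) (x y z : hom W b) :
  exists! w : hom W (cube b),
    [/\ cube_proj b i0 ∘ w = x, cube_proj b i1 ∘ w = y & cube_proj b i2 ∘ w = z].
Proof.
have nat : forall i j (a : @hom discrete_three i j),
  fmap (const_three b) a ∘ match i with i0 => x | i1 => y | i2 => z end
  = match j with i0 => x | i1 => y | i2 => z end.
  by move=> i j a; destruct a; rewrite comp1m.
case: (proj2_sig (cube_limit b) (Cone nat)) => w [hw uw].
exists w; split=> [|w' [h0 h1 h2]].
  by split; [apply: (hw i0) | apply: (hw i1) | apply: (hw i2)].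
by apply: uw; case.
Qed.

Definition tuple (b W : B) (x y z : hom W b) : hom W (cube b) :=
  proj1_sig (constructive_indefinite_description _ (cube_exists_unique x y z)).

Lemma tupleP (b W : B) (x y z : hom W b) :
  [/\ cube_proj b i0 ∘ tuple x y z = x, cube_proj b i1 ∘ tuple x y z = y
    & cube_proj b i2 ∘ tuple x y z = z].
Proof. by rewrite /tuple; case: constructive_indefinite_description => w [[]]. Qed.

Lemma tuple_uniq (b W : B) (x y z : hom W b) w :
  cube_proj b i0 ∘ w = x -> cube_proj b i1 ∘ w = y -> cube_proj b i2 ∘ w = z ->
  tuple x y z = w.
Proof.
move=> h0 h1 h2; rewrite /tuple.
case: constructive_indefinite_description => w' [_ uw] /=.
by apply: uw.
Qed.

Lemma tuple_comp (b W W' : B) (x y z : hom W b) (u : hom W' W) :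
  tuple x y z ∘ u = tuple (x ∘ u) (y ∘ u) (z ∘ u).
Proof.
by case: (tupleP x y z) => h0 h1 h2; symmetry; apply: tuple_uniq;
  rewrite compA ?h0 ?h1 ?h2.
Qed.

Definition cube_map (b b' : B) (f : hom b b') : hom (cube b) (cube b') :=
  tuple (f ∘ cube_proj b i0) (f ∘ cube_proj b i1) (f ∘ cube_proj b i2).

Lemma cube_map_tuple (b b' W : B) (f : hom b b') (x y z : hom W b) :
  cube_map f ∘ tuple x y z = tuple (f ∘ x) (f ∘ y) (f ∘ z).
Proof. by case: (tupleP x y z) => h0 h1 h2; rewrite tuple_comp -!compA h0 h1 h2. Qed.

Definition cube_functor : functor B B.
Proof.
refine (@Functor B B cube cube_map _ _).
- by move=> b; apply: tuple_uniq; rewrite comp1m compm1.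
- by move=> a b c g f; rewrite [cube_map f]/cube_map cube_map_tuple !compA.
Defined.

End Cube.

Arguments tuple {B} limB {b W} x y z.

Record maltsev_operation (A B : category) (limB : has_finite_limits B)
  (V : functor A B) := MaltsevOperation {
  mop :> nat_trans (functor_comp (cube_functor limB) V) V;
  mop_xyy : forall (X : A) (W : B) (x y : hom W (V X)),
    mop X ∘ tuple limB x y y = x;
  mop_yyx : forall (X : A) (W : B) (x y : hom W (V X)),
    mop X ∘ tuple limB y y x = x }.

Section WeaklyMaltsev.
Context (A : category) (X Y Z : A) (f : hom X Y) (g : hom Z Y)
  (r : hom Y X) (s : hom Y Z).

Lemma split_left (gs : g ∘ s = idm Y) : f ∘ idm X = g ∘ (s ∘ f).
Proof. by rewrite compA gs comp1m compm1. Qed.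

Lemma split_right (fr : f ∘ r = idm Y) : f ∘ (r ∘ g) = g ∘ idm Z.
Proof. by rewrite compA fr comp1m compm1. Qed.

End WeaklyMaltsev.

Definition jointly_epic (A : category) (X Y P : A) (i : hom X P) (j : hom Y P) :=
  forall (W : A) (u v : hom P W), u ∘ i = v ∘ i -> u ∘ j = v ∘ j -> u = v.

Definition weakly_maltsev (A : category) : Prop :=
  forall (X Y Z : A) (f : hom X Y) (g : hom Z Y) (r : hom Y X) (s : hom Y Z)
    (fr : f ∘ r = idm Y) (gs : g ∘ s = idm Y) (P : pullback f g),
    jointly_epic (pb_pair P (split_left f gs)) (pb_pair P (split_right g fr)).

(* Strict 2-categories. The 2-cells [X -> Y] form a single type with [cdom] and
   [ccod]; the value of [vcomp τ σ] (first σ, then τ) is only meaningful when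
   [cdom τ = ccod σ]. *)
Record two_category := TwoCategory {
  underlying :> category;
  cell : underlying -> underlying -> Type;
  cdom : forall X Y, cell X Y -> hom X Y;
  ccod : forall X Y, cell X Y -> hom X Y;
  idc : forall X Y, hom X Y -> cell X Y;
  vcomp : forall X Y, cell X Y -> cell X Y -> cell X Y;
  lwhisk : forall X Y Z, hom Y Z -> cell X Y -> cell X Z;
  rwhisk : forall X Y Z, cell Y Z -> hom X Y -> cell X Z;
  cdom_idc : forall X Y (f : hom X Y), cdom (idc f) = f;
  ccod_idc : forall X Y (f : hom X Y), ccod (idc f) = f;
  cdom_vcomp : forall X Y (τ σ : cell X Y),
    cdom τ = ccod σ -> cdom (vcomp τ σ) = cdom σ;
  ccod_vcomp : forall X Y (τ σ : cell X Y),
    cdom τ = ccod σ -> ccod (vcomp τ σ) = ccod τ;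
  vcomp1c : forall X Y (τ : cell X Y), vcomp (idc (ccod τ)) τ = τ;
  vcompc1 : forall X Y (τ : cell X Y), vcomp τ (idc (cdom τ)) = τ;
  vcompA : forall X Y (τ σ υ : cell X Y), cdom τ = ccod σ -> cdom σ = ccod υ ->
    vcomp τ (vcomp σ υ) = vcomp (vcomp τ σ) υ;
  cdom_lwhisk : forall X Y Z (v : hom Y Z) (τ : cell X Y),
    cdom (lwhisk v τ) = v ∘ cdom τ;
  ccod_lwhisk : forall X Y Z (v : hom Y Z) (τ : cell X Y),
    ccod (lwhisk v τ) = v ∘ ccod τ;
  cdom_rwhisk : forall X Y Z (τ : cell Y Z) (u : hom X Y),
    cdom (rwhisk τ u) = cdom τ ∘ u;
  ccod_rwhisk : forall X Y Z (τ : cell Y Z) (u : hom X Y),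
    ccod (rwhisk τ u) = ccod τ ∘ u;
  lwhisk_idc : forall X Y Z (v : hom Y Z) (f : hom X Y),
    lwhisk v (idc f) = idc (v ∘ f);
  rwhisk_idc : forall X Y Z (f : hom Y Z) (u : hom X Y),
    rwhisk (idc f) u = idc (f ∘ u);
  lwhisk_vcomp : forall X Y Z (v : hom Y Z) (τ σ : cell X Y), cdom τ = ccod σ ->
    lwhisk v (vcomp τ σ) = vcomp (lwhisk v τ) (lwhisk v σ);
  rwhisk_vcomp : forall X Y Z (τ σ : cell Y Z) (u : hom X Y), cdom τ = ccod σ ->
    rwhisk (vcomp τ σ) u = vcomp (rwhisk τ u) (rwhisk σ u);
  lwhisk1 : forall X Y (τ : cell X Y), lwhisk (idm Y) τ = τ;
  rwhisk1 : forall X Y (τ : cell X Y), rwhisk τ (idm X) = τ;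
  lwhiskA : forall W X Y Z (v' : hom Y Z) (v : hom X Y) (τ : cell W X),
    lwhisk (v' ∘ v) τ = lwhisk v' (lwhisk v τ);
  rwhiskA : forall W X Y Z (τ : cell Y Z) (u : hom X Y) (u' : hom W X),
    rwhisk τ (u ∘ u') = rwhisk (rwhisk τ u) u';
  lrwhiskA : forall W X Y Z (v : hom Y Z) (τ : cell X Y) (u : hom W X),
    rwhisk (lwhisk v τ) u = lwhisk v (rwhisk τ u);
  interchange : forall X Y Z (σ : cell Y Z) (τ : cell X Y),
    vcomp (rwhisk σ (ccod τ)) (lwhisk (cdom σ) τ)
    = vcomp (lwhisk (ccod σ) τ) (rwhisk σ (cdom τ)) }.

Arguments cell {t} X Y.
Arguments cdom {t X Y} τ.
Arguments ccod {t X Y} τ.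
Arguments idc {t X Y} f.
Arguments vcomp {t X Y} τ σ.
Arguments lwhisk {t X Y Z} v τ.
Arguments rwhisk {t X Y Z} τ u.
Notation "v ◁ τ" := (lwhisk v τ) (at level 40, left associativity) : cat_scope.
Notation "τ ▷ u" := (rwhisk τ u) (at level 40, left associativity) : cat_scope.
Notation "τ • σ" := (vcomp τ σ) (at level 50, left associativity) : cat_scope.

Definition invertible (K : two_category) (X Y : K) (τ : cell X Y) : Prop :=
  exists σ : cell X Y, [/\ cdom σ = ccod τ, ccod σ = cdom τ,
    σ • τ = idc (cdom τ) & τ • σ = idc (ccod τ)].

(* Pullbacks in a 2-category: the universal property also holds for 2-cells,
   which is what gives a meaning to [α × 1] and [1 × α]. *)
Record pullback2 (K : two_category) (X Y Z : K) (f : hom X Z) (g : hom Y Z) :=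
  Pullback2 {
  pb2_pb :> pullback f g;
  pb_cpair : forall (W : K) (σ : cell W X) (τ : cell W Y),
    f ◁ σ = g ◁ τ -> cell W pb2_pb;
  pb_cpair1 : forall (W : K) (σ : cell W X) (τ : cell W Y) (h : f ◁ σ = g ◁ τ),
    pb1 pb2_pb ◁ pb_cpair h = σ;
  pb_cpair2 : forall (W : K) (σ : cell W X) (τ : cell W Y) (h : f ◁ σ = g ◁ τ),
    pb2 pb2_pb ◁ pb_cpair h = τ;
  pb_cuniq : forall (W : K) (κ κ' : cell W pb2_pb),
    pb1 pb2_pb ◁ κ = pb1 pb2_pb ◁ κ' -> pb2 pb2_pb ◁ κ = pb2 pb2_pb ◁ κ' ->
    κ = κ' }.

Arguments pb_cpair {K X Y Z f g} P {W σ τ} h : rename.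

Definition pullbacks (K : two_category) : Type :=
  forall (X Y Z : K) (f : hom X Z) (g : hom Y Z), pullback2 f g.

Section Pseudocategory.
Context (K : two_category) (PB : pullbacks K) (C0 C1 : K)
  (d c : hom C1 C0) (e : hom C0 C1).

(* [prod3] and [prod4] are bracketed to the right, e.g. C1 ×_C0 (C1 ×_C0 C1). *)
Definition prod2 : pullback2 d c := PB d c.
Definition prod3 : pullback2 d (c ∘ pb1 prod2) := PB d (c ∘ pb1 prod2).
Definition prod4 : pullback2 d (c ∘ pb1 prod3) := PB d (c ∘ pb1 prod3).

Definition pi2_1 : hom prod2 C1 := pb1 prod2.
Definition pi2_2 : hom prod2 C1 := pb2 prod2.
Definition pi3_1 : hom prod3 C1 := pb1 prod3.
Definition pi3_2 : hom prod3 C1 := pi2_1 ∘ pb2 prod3.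
Definition pi3_3 : hom prod3 C1 := pi2_2 ∘ pb2 prod3.
Definition pi4_1 : hom prod4 C1 := pb1 prod4.
Definition pi4_2 : hom prod4 C1 := pi3_1 ∘ pb2 prod4.
Definition pi4_3 : hom prod4 C1 := pi3_2 ∘ pb2 prod4.
Definition pi4_4 : hom prod4 C1 := pi3_3 ∘ pb2 prod4.

Definition pair2 (W : K) (x y : hom W C1) (xy : d ∘ x = c ∘ y) : hom W prod2 :=
  pb_pair prod2 xy.

Lemma pair3_proof (W : K) (x y z : hom W C1) (xy : d ∘ x = c ∘ y)
  (yz : d ∘ y = c ∘ z) : d ∘ x = (c ∘ pi2_1) ∘ pair2 yz.
Proof. by rewrite -compA pb_pair1. Qed.

Definition pair3 (W : K) (x y z : hom W C1) (xy : d ∘ x = c ∘ y)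
  (yz : d ∘ y = c ∘ z) : hom W prod3 :=
  pb_pair prod3 (pair3_proof xy yz).

Lemma comm2 : d ∘ pi2_1 = c ∘ pi2_2.
Proof. exact: pb_comm. Qed.
Lemma comm3_12 : d ∘ pi3_1 = c ∘ pi3_2.
Proof. by rewrite /pi3_1 pb_comm -compA. Qed.
Lemma comm3_23 : d ∘ pi3_2 = c ∘ pi3_3.
Proof. by rewrite /pi3_2 /pi3_3 compA comm2 compA. Qed.
Lemma comm4_12 : d ∘ pi4_1 = c ∘ pi4_2.
Proof. by rewrite /pi4_1 pb_comm -compA. Qed.
Lemma comm4_23 : d ∘ pi4_2 = c ∘ pi4_3.
Proof. by rewrite /pi4_2 /pi4_3 compA comm3_12 compA. Qed.
Lemma comm4_34 : d ∘ pi4_3 = c ∘ pi4_4.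
Proof. by rewrite /pi4_3 /pi4_4 compA comm3_23 compA. Qed.

Context (m : hom prod2 C1).

Definition mul (W : K) (x y : hom W C1) (xy : d ∘ x = c ∘ y) : hom W C1 :=
  m ∘ pair2 xy.

Section Units.
Hypotheses (de : d ∘ e = idm C0) (ce : c ∘ e = idm C0).

Lemma e1_proof : d ∘ idm C1 = c ∘ (e ∘ d).
Proof. by rewrite compA ce comp1m compm1. Qed.
Lemma e2_proof : d ∘ (e ∘ c) = c ∘ idm C1.
Proof. by rewrite compA de comp1m compm1. Qed.

Definition e1 : hom C1 prod2 := pair2 e1_proof.
Definition e2 : hom C1 prod2 := pair2 e2_proof.

Lemma mid_unit_proof1 : d ∘ pi2_1 = c ∘ (e ∘ d ∘ pi2_1).
Proof. by rewrite !compA ce comp1m. Qed.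
Lemma mid_unit_proof2 : d ∘ (e ∘ d ∘ pi2_1) = c ∘ pi2_2.
Proof. by rewrite !compA de comp1m comm2. Qed.

Definition mid_unit : hom prod2 prod3 := pair3 mid_unit_proof1 mid_unit_proof2.

End Units.

Section Products.
Hypotheses (dm : d ∘ m = d ∘ pi2_2) (cm : c ∘ m = c ∘ pi2_1).

Lemma d_mul (W : K) (x y : hom W C1) (xy : d ∘ x = c ∘ y) : d ∘ mul xy = d ∘ y.
Proof. by rewrite /mul compA dm -compA pb_pair2. Qed.
Lemma c_mul (W : K) (x y : hom W C1) (xy : d ∘ x = c ∘ y) : c ∘ mul xy = c ∘ x.
Proof. by rewrite /mul compA cm -compA pb_pair1. Qed.

Lemma mul_left_proof (W : K) (x y z : hom W C1) (xy : d ∘ x = c ∘ y)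
  (yz : d ∘ y = c ∘ z) : d ∘ mul xy = c ∘ z.
Proof. by rewrite d_mul. Qed.
Lemma mul_right_proof (W : K) (x y z : hom W C1) (xy : d ∘ x = c ∘ y)
  (yz : d ∘ y = c ∘ z) : d ∘ x = c ∘ mul yz.
Proof. by rewrite c_mul. Qed.

Definition one_m : hom prod3 prod2 := pair2 (mul_right_proof comm3_12 comm3_23).
Definition m_one : hom prod3 prod2 := pair2 (mul_left_proof comm3_12 comm3_23).

Definition one_one_m : hom prod4 prod3 :=
  pair3 comm4_12 (mul_right_proof comm4_23 comm4_34).
Definition one_m_one : hom prod4 prod3 :=
  pair3 (mul_right_proof comm4_12 comm4_23) (mul_left_proof comm4_23 comm4_34).
Definition m_one_one : hom prod4 prod3 :=
  pair3 (mul_left_proof comm4_12 comm4_23) comm4_34.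

End Products.

Section Cells.
Context (α : cell prod3 C1) (lam rho : cell C1 C1).
Hypotheses (dα : d ◁ α = idc (d ∘ pi3_3)) (cα : c ◁ α = idc (c ∘ pi3_1))
  (clam : c ◁ lam = idc c) (drho : d ◁ rho = idc d).

Lemma one_α_proof : d ◁ idc pi4_1 = c ◁ (α ▷ pb2 prod4).
Proof. by rewrite -lrwhiskA cα lwhisk_idc rwhisk_idc /pi4_1 pb_comm. Qed.

Lemma α_one_proof : d ◁ (α ▷ pair3 comm4_12 comm4_23) = c ◁ idc pi4_4.
Proof.
rewrite -lrwhiskA dα lwhisk_idc rwhisk_idc -!compA pb_pair2 pb_pair2.
by rewrite comm4_34.
Qed.

Lemma rho_one_proof : d ◁ (rho ▷ pi2_1) = c ◁ idc pi2_2.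
Proof. by rewrite -lrwhiskA drho lwhisk_idc rwhisk_idc comm2. Qed.

Lemma one_lam_proof : d ◁ idc pi2_1 = c ◁ (lam ▷ pi2_2).
Proof. by rewrite -lrwhiskA clam lwhisk_idc rwhisk_idc comm2. Qed.

Definition one_α : cell prod4 prod2 := pb_cpair prod2 one_α_proof.
Definition α_one : cell prod4 prod2 := pb_cpair prod2 α_one_proof.
Definition rho_one : cell prod2 prod2 := pb_cpair prod2 rho_one_proof.
Definition one_lam : cell prod2 prod2 := pb_cpair prod2 one_lam_proof.

End Cells.

Record pseudocategory (α : cell prod3 C1) (lam rho : cell C1 C1) : Prop :=
  Pseudocategory {
  pc_de : d ∘ e = idm C0;
  pc_ce : c ∘ e = idm C0;
  pc_dm : d ∘ m = d ∘ pi2_2;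
  pc_cm : c ∘ m = c ∘ pi2_1;
  pc_α_inv : invertible α;
  pc_α_dom : cdom α = m ∘ one_m pc_cm;
  pc_α_cod : ccod α = m ∘ m_one pc_dm;
  pc_lam_inv : invertible lam;
  pc_lam_dom : cdom lam = m ∘ e2 pc_de;
  pc_lam_cod : ccod lam = idm C1;
  pc_rho_inv : invertible rho;
  pc_rho_dom : cdom rho = m ∘ e1 pc_ce;
  pc_rho_cod : ccod rho = idm C1;
  pc_dlam : d ◁ lam = idc d;
  pc_drho : d ◁ rho = idc d;
  pc_clam : c ◁ lam = idc c;
  pc_crho : c ◁ rho = idc c;
  pc_dα : d ◁ α = idc (d ∘ pi3_3);
  pc_cα : c ◁ α = idc (c ∘ pi3_1);
  pc_unit : lam ▷ e = rho ▷ e;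
  pc_pentagon :
    (α ▷ m_one_one pc_dm) • (α ▷ one_one_m pc_cm)
    = (m ◁ α_one pc_dα) • (α ▷ one_m_one pc_dm pc_cm) • (m ◁ one_α pc_cα);
  pc_triangle :
    (m ◁ rho_one pc_drho) • (α ▷ mid_unit pc_de pc_ce) = m ◁ one_lam pc_clam }.

Definition homogeneous_pseudocategory (α : cell prod3 C1) (lam rho : cell C1 C1) :
  Prop :=
  pseudocategory α lam rho /\ lam ▷ e = idc e /\ rho ▷ e = idc e.

End Pseudocategory.

Arguments prod2 {K} PB {C0 C1} d c.
Arguments prod3 {K} PB {C0 C1} d c.
Arguments prod4 {K} PB {C0 C1} d c.
Arguments pi2_1 {K PB C0 C1 d c}.
Arguments pi2_2 {K PB C0 C1 d c}.
Arguments pi3_1 {K PB C0 C1 d c}.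
Arguments pi3_2 {K PB C0 C1 d c}.
Arguments pi3_3 {K PB C0 C1 d c}.
Arguments pseudocategory {K} PB {C0 C1} d c e m α lam rho.
Arguments homogeneous_pseudocategory {K} PB {C0 C1} d c e m α lam rho.

Section GA.
Context (A B : category) (limA : has_finite_limits A) (limB : has_finite_limits B)
  (V : functor A B) (faithV : faithful V) (presV : preserves_finite_limits V)
  (p : maltsev_operation limB V).

Definition pt (X : A) (W : B) (x y z : hom W (V X)) : hom W (V X) :=
  p X ∘ tuple limB x y z.

Lemma pt_xyy (X : A) (W : B) (x y : hom W (V X)) : pt x y y = x.
Proof. exact: mop_xyy. Qed.
Lemma pt_yyx (X : A) (W : B) (x y : hom W (V X)) : pt y y x = x.
Proof. exact: mop_yyx. Qed.
Lemma pt_comp (X : A) (W W' : B) (x y z : hom W (V X)) (u : hom W' W) :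
  pt x y z ∘ u = pt (x ∘ u) (y ∘ u) (z ∘ u).
Proof. by rewrite /pt -compA tuple_comp. Qed.
Lemma pt_map (X Y : A) (W : B) (f : hom X Y) (x y z : hom W (V X)) :
  fmap V f ∘ pt x y z = pt (fmap V f ∘ x) (fmap V f ∘ y) (fmap V f ∘ z).
Proof.
rewrite /pt -cube_map_tuple !compA; congr (_ ∘ _).
by rewrite -(naturality p f).
Qed.

Record gobj := GObj {
  carrier :> A;
  gs : hom carrier carrier;
  gt : hom carrier carrier;
  gst : gs ∘ gt = gt;
  gts : gt ∘ gs = gs;
  gP1 : forall (X : A) (a b c : hom X carrier), gs ∘ a = gs ∘ b -> gt ∘ b = gt ∘ c ->
    exists! φ : hom X carrier, fmap V φ = pt (fmap V a) (fmap V b) (fmap V c) }.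

Record ghom (C' C : gobj) := GHom {
  arr : hom (carrier C') (carrier C);
  arr_s : gs C ∘ arr = arr ∘ gs C';
  arr_t : gt C ∘ arr = arr ∘ gt C' }.

(* The elements of [H(C', C)]; the 2-cell structure [gdom τ ⇒ gcod τ] on them is derived
   below. *)
Record gcell (C' C : gobj) := GCell {
  carr : hom (carrier C') (carrier C);
  carr_s : gs C ∘ carr ∘ gs C' = gs C ∘ carr;
  carr_t : gt C ∘ carr ∘ gt C' = gt C ∘ carr }.

Lemma ghom_eq (C' C : gobj) (f g : ghom C' C) : arr f = arr g -> f = g.
Proof.
case: f g => [f fs ft] [g gs' gt'] /= fg; subst g.
by rewrite (proof_irrelevance _ fs gs') (proof_irrelevance _ ft gt').
Qed.

Lemma gcell_eq (C' C : gobj) (f g : gcell C' C) : carr f = carr g -> f = g.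
Proof.
case: f g => [f fs ft] [g gs' gt'] /= fg; subst g.
by rewrite (proof_irrelevance _ fs gs') (proof_irrelevance _ ft gt').
Qed.

Lemma gss (C : gobj) : gs C ∘ gs C = gs C.
Proof. by rewrite -{2}(gts C) compA gst gts. Qed.
Lemma gtt (C : gobj) : gt C ∘ gt C = gt C.
Proof. by rewrite -{2}(gst C) compA gts gst. Qed.

Lemma gssr (C : gobj) X (x : hom X (carrier C)) : gs C ∘ (gs C ∘ x) = gs C ∘ x.
Proof. by rewrite compA gss. Qed.
Lemma gttr (C : gobj) X (x : hom X (carrier C)) : gt C ∘ (gt C ∘ x) = gt C ∘ x.
Proof. by rewrite compA gtt. Qed.
Lemma gstr (C : gobj) X (x : hom X (carrier C)) : gs C ∘ (gt C ∘ x) = gt C ∘ x.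
Proof. by rewrite compA gst. Qed.
Lemma gtsr (C : gobj) X (x : hom X (carrier C)) : gt C ∘ (gs C ∘ x) = gs C ∘ x.
Proof. by rewrite compA gts. Qed.

(* The morphism φ with [V φ = p⟨V a, V b, V c⟩] if there is one (it is then unique,
   [V] being faithful), and [a] otherwise. *)
Definition fill (X Y : A) (a b c : hom X Y) : hom X Y :=
  match excluded_middle_informative
    (exists φ : hom X Y, fmap V φ = pt (fmap V a) (fmap V b) (fmap V c)) with
  | left h => proj1_sig (constructive_indefinite_description _ h)
  | right _ => a
  end.

Lemma fill_cases (X Y : A) (a b c : hom X Y) :
  fmap V (fill a b c) = pt (fmap V a) (fmap V b) (fmap V c) \/ fill a b c = a.
Proof.
rewrite /fill; case: excluded_middle_informative => [h|_]; last by right.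
by left; case: constructive_indefinite_description.
Qed.

Lemma fillP (C : gobj) (X : A) (a b c : hom X C) :
  gs C ∘ a = gs C ∘ b -> gt C ∘ b = gt C ∘ c ->
  fmap V (fill a b c) = pt (fmap V a) (fmap V b) (fmap V c).
Proof.
move=> sab tbc; rewrite /fill; case: excluded_middle_informative => [h|h].
  by case: constructive_indefinite_description.
by case: h; case: (gP1 sab tbc) => φ [hφ _]; exists φ.
Qed.

(* [p] restricted to admissible triples is a morphism of [A], hence commutes with [p]. *)
Lemma pt_exchange (C : gobj) (W : B) (x1 y1 z1 x2 y2 z2 x3 y3 z3 : hom W (V C)) :
  let s := fmap V (gs C) in let t := fmap V (gt C) in
  s ∘ x1 = s ∘ y1 -> t ∘ y1 = t ∘ z1 ->
  s ∘ x2 = s ∘ y2 -> t ∘ y2 = t ∘ z2 ->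
  s ∘ x3 = s ∘ y3 -> t ∘ y3 = t ∘ z3 ->
  pt (pt x1 y1 z1) (pt x2 y2 z2) (pt x3 y3 z3)
  = pt (pt x1 x2 x3) (pt y1 y2 y3) (pt z1 z2 z3).
Proof.
move=> s t.
pose P := lim_pullback limA (gs C) (gs C).
pose Q := lim_pullback limA (gt C ∘ pb2 P) (gt C).
pose a := pb1 P ∘ pb1 Q; pose b := pb2 P ∘ pb1 Q; pose c := pb2 Q.
have sab : gs C ∘ a = gs C ∘ b by rewrite !compA pb_comm.
have tbc : gt C ∘ b = gt C ∘ c by rewrite compA pb_comm.
case: (gP1 sab tbc) => φ [hφ _].
have lift : forall x y z, s ∘ x = s ∘ y -> t ∘ y = t ∘ z ->
    exists w : hom W (V Q), (fmap V a ∘ w = x /\ fmap V b ∘ w = y) /\ fmap V c ∘ w = z.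
  move=> x y z sxy tyz.
  case: (preserved_pair limA presV sxy) => w [w1 w2].
  have h : fmap V (gt C ∘ pb2 P) ∘ w = fmap V (gt C) ∘ z by rewrite fmapM -compA w2.
  case: (preserved_pair limA presV h) => v [v1 v2].
  by exists v; rewrite !fmapM -!compA v1 w1 w2 v2.
move=> sx1 ty1 sx2 ty2 sx3 ty3.
case: (lift _ _ _ sx1 ty1) => w1 [[<- <-] <-].
case: (lift _ _ _ sx2 ty2) => w2 [[<- <-] <-].
case: (lift _ _ _ sx3 ty3) => w3 [[<- <-] <-].
by rewrite -!pt_comp -hφ -!pt_map hφ -pt_comp.
Qed.

Section Laws.
Context (C : gobj) (W : B).
Implicit Types x y z u v w a b : hom W (V C).
Let s := fmap V (gs C).
Let t := fmap V (gt C).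

Lemma V_tt x : t ∘ (t ∘ x) = t ∘ x.
Proof. by rewrite compA -fmapM gtt. Qed.

Lemma pt_assoc x y z u v : s ∘ x = s ∘ y -> t ∘ y = t ∘ z -> t ∘ u = t ∘ v ->
  pt (pt x y z) u v = pt x y (pt z u v).
Proof.
move=> sxy tyz tuv; have tt := V_tt u.
rewrite -[u in LHS](pt_yyx u (t ∘ u)) -[v in LHS](pt_yyx v (t ∘ u)).
by rewrite (pt_exchange (C := C)) -/s -/t ?tt // !pt_xyy.
Qed.

Lemma pt_cancel_left w a b y z : s ∘ a = s ∘ b -> t ∘ b = t ∘ y -> t ∘ b = t ∘ z ->
  pt w (pt a b y) (pt a b z) = pt w y z.
Proof.
move=> sab tby tbz.
rewrite -[w in LHS](pt_yyx w w).
by rewrite (pt_exchange (C := C)) -/s -/t // !pt_xyy pt_yyx.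
Qed.

Lemma pt_cancel_right x y w a b : s ∘ x = s ∘ a -> s ∘ y = s ∘ a -> t ∘ a = t ∘ b ->
  pt (pt x a b) (pt y a b) w = pt x y w.
Proof.
move=> sxa sya tab.
rewrite -[w in LHS](pt_xyy w w).
by rewrite (pt_exchange (C := C)) -/s -/t // !pt_yyx pt_xyy.
Qed.

End Laws.

Definition ghom_id (C : gobj) : ghom C C.
Proof. by exists (idm (carrier C)); rewrite comp1m compm1. Defined.

Definition ghom_comp (C D E : gobj) (g : ghom D E) (f : ghom C D) : ghom C E.
Proof.
exists (arr g ∘ arr f).
- by rewrite compA arr_s -compA arr_s compA.
- by rewrite compA arr_t -compA arr_t compA.
Defined.

Definition gcat : category.
Proof.
refine {| ob := gobj; hom := ghom; idm := ghom_id; comp := ghom_comp |}.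
- by move=> C D f; apply: ghom_eq; apply: comp1m.
- by move=> C D f; apply: ghom_eq; apply: compm1.
- by move=> C D E F h g f; apply: ghom_eq; apply: compA.
Defined.

Section Cells.
Context (C' C : gobj).
Implicit Types (τ σ : gcell C' C) (f g : ghom C' C).

Lemma dom_admissible τ :
  gs C ∘ (gs C ∘ carr τ ∘ gt C') = gs C ∘ (carr τ ∘ gt C') /\
  gt C ∘ (carr τ ∘ gt C') = gt C ∘ carr τ.
Proof. by split; [rewrite -!compA gssr | rewrite compA carr_t]. Qed.

Lemma cod_admissible τ :
  gs C ∘ carr τ = gs C ∘ (carr τ ∘ gs C') /\
  gt C ∘ (carr τ ∘ gs C') = gt C ∘ (gt C ∘ carr τ ∘ gs C').
Proof. by split; [rewrite compA carr_s | rewrite -!compA gttr]. Qed.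

Definition dom_arr τ : hom (carrier C') (carrier C) :=
  fill (gs C ∘ carr τ ∘ gt C') (carr τ ∘ gt C') (carr τ).

Definition cod_arr τ : hom (carrier C') (carrier C) :=
  fill (carr τ) (carr τ ∘ gs C') (gt C ∘ carr τ ∘ gs C').

Lemma V_dom τ : fmap V (dom_arr τ) =
  pt (fmap V (gs C ∘ carr τ ∘ gt C')) (fmap V (carr τ ∘ gt C')) (fmap V (carr τ)).
Proof. by case: (dom_admissible τ) => h1 h2; apply: fillP. Qed.

Lemma V_cod τ : fmap V (cod_arr τ) =
  pt (fmap V (carr τ)) (fmap V (carr τ ∘ gs C')) (fmap V (gt C ∘ carr τ ∘ gs C')).
Proof. by case: (cod_admissible τ) => h1 h2; apply: fillP. Qed.

Lemma s_dom τ : gs C ∘ dom_arr τ = gs C ∘ carr τ.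
Proof. by apply: faithV; rewrite fmapM V_dom pt_map -!fmapM -!compA gssr pt_yyx. Qed.
Lemma t_dom τ : gt C ∘ dom_arr τ = gs C ∘ carr τ ∘ gt C'.
Proof.
apply: faithV; rewrite fmapM V_dom pt_map -!fmapM -!compA gtsr.
by rewrite [gt C ∘ (_ ∘ _)]compA carr_t pt_xyy.
Qed.
Lemma s_cod τ : gs C ∘ cod_arr τ = gt C ∘ carr τ ∘ gs C'.
Proof.
apply: faithV; rewrite fmapM V_cod pt_map -!fmapM -!compA gstr.
by rewrite [gs C ∘ (_ ∘ _)]compA carr_s pt_yyx.
Qed.
Lemma t_cod τ : gt C ∘ cod_arr τ = gt C ∘ carr τ.
Proof. by apply: faithV; rewrite fmapM V_cod pt_map -!fmapM -!compA gttr pt_xyy. Qed.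

Lemma dom_arr_s τ : gs C ∘ dom_arr τ = dom_arr τ ∘ gs C'.
Proof.
rewrite s_dom; apply: faithV; rewrite [in RHS]fmapM V_dom pt_comp -!fmapM.
by rewrite -!compA gts pt_xyy compA carr_s.
Qed.
Lemma dom_arr_t τ : gt C ∘ dom_arr τ = dom_arr τ ∘ gt C'.
Proof.
rewrite t_dom; apply: faithV; rewrite [in RHS]fmapM V_dom pt_comp -!fmapM.
by rewrite -!compA gtt pt_xyy.
Qed.
Lemma cod_arr_s τ : gs C ∘ cod_arr τ = cod_arr τ ∘ gs C'.
Proof.
rewrite s_cod; apply: faithV; rewrite [in RHS]fmapM V_cod pt_comp -!fmapM.
by rewrite -!compA gss pt_yyx.
Qed.
Lemma cod_arr_t τ : gt C ∘ cod_arr τ = cod_arr τ ∘ gt C'.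
Proof.
rewrite t_cod; apply: faithV; rewrite [in RHS]fmapM V_cod pt_comp -!fmapM.
by rewrite -!compA gst pt_yyx compA carr_t.
Qed.

Definition gdom τ : ghom C' C := GHom (dom_arr_s τ) (dom_arr_t τ).
Definition gcod τ : ghom C' C := GHom (cod_arr_s τ) (cod_arr_t τ).

Lemma ghom_ss f : gs C ∘ arr f ∘ gs C' = gs C ∘ arr f.
Proof. by rewrite arr_s -compA gss. Qed.
Lemma ghom_tt f : gt C ∘ arr f ∘ gt C' = gt C ∘ arr f.
Proof. by rewrite arr_t -compA gtt. Qed.

Definition gzero f : gcell C' C := GCell (ghom_ss f) (ghom_tt f).

Lemma fill_ss τ1 τ2 τ3 :
  gs C ∘ fill (carr τ1) (carr τ2) (carr τ3) ∘ gs C'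
  = gs C ∘ fill (carr τ1) (carr τ2) (carr τ3).
Proof.
case: (fill_cases (carr τ1) (carr τ2) (carr τ3)) => [h|->]; last exact: carr_s.
apply: faithV; rewrite fmapM [in RHS]fmapM (fmapM V (gs C)) h pt_map pt_comp.
by rewrite -!fmapM !carr_s.
Qed.
Lemma fill_tt τ1 τ2 τ3 :
  gt C ∘ fill (carr τ1) (carr τ2) (carr τ3) ∘ gt C'
  = gt C ∘ fill (carr τ1) (carr τ2) (carr τ3).
Proof.
case: (fill_cases (carr τ1) (carr τ2) (carr τ3)) => [h|->]; last exact: carr_t.
apply: faithV; rewrite fmapM [in RHS]fmapM (fmapM V (gt C)) h pt_map pt_comp.
by rewrite -!fmapM !carr_t.
Qed.

Definition fill_cell τ1 τ2 τ3 : gcell C' C :=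
  GCell (fill_ss τ1 τ2 τ3) (fill_tt τ1 τ2 τ3).

(* [τ + σ]; [fill] takes its junk value only when [gdom τ <> gcod σ]. *)
Definition gplus τ σ : gcell C' C := fill_cell τ (gzero (gdom τ)) σ.

Definition gopp τ : gcell C' C := fill_cell (gzero (gdom τ)) τ (gzero (gcod τ)).

Lemma V_plus τ σ : gdom τ = gcod σ ->
  fmap V (carr (gplus τ σ)) =
  pt (fmap V (carr τ)) (fmap V (arr (gdom τ))) (fmap V (carr σ)).
Proof.
move=> h; apply: fillP => /=; first by rewrite s_dom.
by rewrite -[dom_arr τ]/(arr (gdom τ)) h /= t_cod.
Qed.

Lemma V_opp τ : fmap V (carr (gopp τ)) =
  pt (fmap V (arr (gdom τ))) (fmap V (carr τ)) (fmap V (arr (gcod τ))).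
Proof. by apply: fillP => /=; rewrite ?s_dom ?t_cod. Qed.

Lemma dom_zero f : gdom (gzero f) = f.
Proof.
apply: ghom_eq; apply: faithV; rewrite V_dom /= arr_s -compA gst.
by rewrite pt_yyx.
Qed.

Lemma cod_zero f : gcod (gzero f) = f.
Proof.
apply: ghom_eq; apply: faithV; rewrite V_cod /= arr_t -compA gts.
by rewrite pt_xyy.
Qed.

Lemma cell_dom_decomp τ : fmap V (carr τ) =
  pt (fmap V (carr τ ∘ gt C')) (fmap V (gs C ∘ carr τ ∘ gt C'))
     (fmap V (dom_arr τ)).
Proof.
rewrite V_dom -pt_assoc -?fmapM.
- by rewrite pt_xyy pt_yyx.
- by rewrite -!compA gssr.
- by [].
- by rewrite compA carr_t.
Qed.

Lemma cell_cod_decomp τ : fmap V (carr τ) =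
  pt (fmap V (cod_arr τ)) (fmap V (gt C ∘ carr τ ∘ gs C'))
     (fmap V (carr τ ∘ gs C')).
Proof.
rewrite V_cod pt_assoc -?fmapM.
- by rewrite pt_yyx pt_xyy.
- by rewrite compA carr_s.
- by rewrite -!compA gttr.
- by rewrite -!compA gttr.
Qed.

Section Composable.
Context (τ σ : gcell C' C) (h : gdom τ = gcod σ).

Lemma dom_cod_arr : dom_arr τ = cod_arr σ.
Proof. by move: (f_equal (@arr _ _) h). Qed.

Lemma dom_cod_mid : gs C ∘ carr τ ∘ gt C' = gt C ∘ carr σ.
Proof. by rewrite -t_dom dom_cod_arr t_cod. Qed.

Lemma dom_cod_mid' : gs C ∘ carr τ = gt C ∘ carr σ ∘ gs C'.
Proof. by rewrite -s_dom dom_cod_arr s_cod. Qed.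

Lemma V_plus_left : fmap V (carr (gplus τ σ)) =
  pt (fmap V (carr τ ∘ gt C')) (fmap V (gs C ∘ carr τ ∘ gt C'))
     (fmap V (carr σ)).
Proof.
rewrite V_plus // {1}cell_dom_decomp /= pt_assoc -?fmapM ?pt_yyx //.
- by rewrite -!compA gssr.
- by rewrite t_dom -!compA gtsr.
- by rewrite t_dom dom_cod_mid.
Qed.

Lemma V_plus_right : fmap V (carr (gplus τ σ)) =
  pt (fmap V (carr τ)) (fmap V (gt C ∘ carr σ ∘ gs C'))
     (fmap V (carr σ ∘ gs C')).
Proof.
rewrite V_plus // [fmap V (carr σ)]cell_cod_decomp /= -dom_cod_arr.
rewrite -pt_assoc -?fmapM ?pt_xyy //.
- by rewrite s_dom.
- by rewrite -!compA gttr.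
Qed.

Lemma s_plus : gs C ∘ carr (gplus τ σ) = gs C ∘ carr σ.
Proof.
apply: faithV; rewrite fmapM V_plus_left pt_map -!fmapM -!compA gssr.
by rewrite pt_yyx.
Qed.

Lemma t_plus : gt C ∘ carr (gplus τ σ) = gt C ∘ carr τ.
Proof.
apply: faithV; rewrite fmapM V_plus_right pt_map -!fmapM -!compA gttr.
by rewrite pt_xyy.
Qed.

Lemma dom_plus : gdom (gplus τ σ) = gdom σ.
Proof.
apply: ghom_eq; apply: faithV; rewrite /= !V_dom s_plus.
rewrite [fmap V (carr (gplus τ σ) ∘ _)]fmapM V_plus_left pt_comp -!fmapM.
rewrite -!compA gtt pt_cancel_left -?fmapM //.
- by rewrite gssr.
- by rewrite gtsr [gt C ∘ (_ ∘ _)]compA carr_t compA dom_cod_mid.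
- by rewrite gtsr compA dom_cod_mid.
Qed.

Lemma cod_plus : gcod (gplus τ σ) = gcod τ.
Proof.
apply: ghom_eq; apply: faithV; rewrite /= !V_cod t_plus.
rewrite [fmap V (carr (gplus τ σ) ∘ _)]fmapM V_plus_right pt_comp -!fmapM.
rewrite -!compA gss pt_cancel_right -?fmapM //.
- by rewrite gstr compA dom_cod_mid'.
- by rewrite gstr [gs C ∘ (_ ∘ _)]compA carr_s dom_cod_mid' compA.
- by rewrite gttr.
Qed.

End Composable.

Lemma plus0c τ : gplus (gzero (gcod τ)) τ = τ.
Proof.
apply: gcell_eq; apply: faithV; rewrite V_plus dom_zero //.
by rewrite pt_yyx.
Qed.

Lemma plusc0 τ : gplus τ (gzero (gdom τ)) = τ.
Proof.
apply: gcell_eq; apply: faithV; rewrite V_plus ?cod_zero //=.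
by rewrite pt_xyy.
Qed.

Lemma plusA τ σ υ : gdom τ = gcod σ -> gdom σ = gcod υ ->
  gplus τ (gplus σ υ) = gplus (gplus τ σ) υ.
Proof.
move=> h1 h2; apply: gcell_eq; apply: faithV.
rewrite !V_plus ?cod_plus ?dom_plus //= pt_assoc -?fmapM //.
- by rewrite s_dom.
- by rewrite (dom_cod_arr h1) t_cod.
- by rewrite (dom_cod_arr h2) t_cod.
Qed.

End Cells.

Definition glwhisk (C D E : gobj) (v : ghom D E) (τ : gcell C D) : gcell C E.
Proof.
exists (arr v ∘ carr τ).
- by rewrite compA arr_s -!compA; congr (_ ∘ _); rewrite compA carr_s.
- by rewrite compA arr_t -!compA; congr (_ ∘ _); rewrite compA carr_t.
Defined.

Definition grwhisk (C D E : gobj) (τ : gcell D E) (u : ghom C D) : gcell C E.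
Proof.
exists (carr τ ∘ arr u).
- by rewrite -!compA -arr_s 2!compA carr_s compA.
- by rewrite -!compA -arr_t 2!compA carr_t compA.
Defined.

Lemma dom_lwhisk (C D E : gobj) (v : ghom D E) (τ : gcell C D) :
  gdom (glwhisk v τ) = ghom_comp v (gdom τ).
Proof.
apply: ghom_eq; apply: faithV; rewrite /= fmapM !V_dom pt_map -!fmapM /=.
by rewrite !compA arr_s.
Qed.

Lemma cod_lwhisk (C D E : gobj) (v : ghom D E) (τ : gcell C D) :
  gcod (glwhisk v τ) = ghom_comp v (gcod τ).
Proof.
apply: ghom_eq; apply: faithV; rewrite /= fmapM !V_cod pt_map -!fmapM /=.
by rewrite !compA arr_t.
Qed.

Lemma dom_rwhisk (C D E : gobj) (τ : gcell D E) (u : ghom C D) :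
  gdom (grwhisk τ u) = ghom_comp (gdom τ) u.
Proof.
apply: ghom_eq; apply: faithV; rewrite /= fmapM !V_dom pt_comp -!fmapM /=.
by rewrite -!compA arr_t.
Qed.

Lemma cod_rwhisk (C D E : gobj) (τ : gcell D E) (u : ghom C D) :
  gcod (grwhisk τ u) = ghom_comp (gcod τ) u.
Proof.
apply: ghom_eq; apply: faithV; rewrite /= fmapM !V_cod pt_comp -!fmapM /=.
by rewrite -!compA arr_s.
Qed.

Lemma lwhisk_plus (C D E : gobj) (v : ghom D E) (τ σ : gcell C D) :
  gdom τ = gcod σ -> glwhisk v (gplus τ σ) = gplus (glwhisk v τ) (glwhisk v σ).
Proof.
move=> h; apply: gcell_eq; apply: faithV.
rewrite V_plus ?dom_lwhisk ?cod_lwhisk ?h //= fmapM V_plus // pt_map -!fmapM /=.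
by rewrite (dom_cod_arr h).
Qed.

Lemma rwhisk_plus (C D E : gobj) (τ σ : gcell D E) (u : ghom C D) :
  gdom τ = gcod σ -> grwhisk (gplus τ σ) u = gplus (grwhisk τ u) (grwhisk σ u).
Proof.
move=> h; apply: gcell_eq; apply: faithV.
rewrite V_plus ?dom_rwhisk ?cod_rwhisk ?h //= fmapM V_plus // pt_comp -!fmapM /=.
by rewrite (dom_cod_arr h).
Qed.

Lemma interchange_left (C D E : gobj) (σ : gcell D E) (τ : gcell C D) :
  fmap V (carr (gplus (grwhisk σ (gcod τ)) (glwhisk (gdom σ) τ)))
  = fmap V (carr σ ∘ carr τ).
Proof.
rewrite V_plus_left /= ?dom_rwhisk ?cod_lwhisk //.
rewrite -!compA -cod_arr_t t_cod [fmap V (dom_arr σ ∘ _)]fmapM V_dom pt_comp.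
rewrite -!fmapM -!compA -pt_assoc -?fmapM ?pt_xyy ?pt_yyx //.
- by rewrite gssr.
- by rewrite !compA carr_t.
Qed.

Lemma interchange_right (C D E : gobj) (σ : gcell D E) (τ : gcell C D) :
  fmap V (carr (gplus (glwhisk (gcod σ) τ) (grwhisk σ (gdom τ))))
  = fmap V (carr σ ∘ carr τ).
Proof.
rewrite V_plus_right /= ?cod_rwhisk ?dom_lwhisk //.
rewrite -!compA -dom_arr_s s_dom [fmap V (cod_arr σ ∘ _)]fmapM V_cod pt_comp.
rewrite -!fmapM -!compA pt_assoc -?fmapM ?pt_xyy ?pt_yyx ?pt_xyy //.
- by rewrite !compA carr_s.
- by rewrite gttr.
- by rewrite gttr.
Qed.

Definition GA : two_category.
Proof.
refine (@TwoCategory gcat gcell gdom gcod gzero gplus glwhisk grwhisk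
  dom_zero cod_zero dom_plus cod_plus plus0c plusc0 plusA
  dom_lwhisk cod_lwhisk dom_rwhisk cod_rwhisk _ _ lwhisk_plus rwhisk_plus
  _ _ _ _ _ _).
- by move=> C D E v f; apply: gcell_eq.
- by move=> C D E f u; apply: gcell_eq.
- by move=> C D τ; apply: gcell_eq; apply: comp1m.
- by move=> C D τ; apply: gcell_eq; apply: compm1.
- by move=> C D E F v' v τ; apply: gcell_eq; rewrite /= compA.
- by move=> C D E F τ u u'; apply: gcell_eq; rewrite /= compA.
- by move=> C D E F v τ u; apply: gcell_eq; rewrite /= compA.
- move=> C D E σ τ; apply: gcell_eq; apply: faithV.
  by rewrite interchange_left interchange_right.
Defined.

Section Pullback.
Context (X Y Z : gobj) (f : ghom X Z) (g : ghom Y Z).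

Let P := lim_pullback limA (arr f) (arr g).

Lemma pull_s_proof : arr f ∘ (gs X ∘ pb1 P) = arr g ∘ (gs Y ∘ pb2 P).
Proof. by rewrite !compA -!arr_s -!compA pb_comm. Qed.
Lemma pull_t_proof : arr f ∘ (gt X ∘ pb1 P) = arr g ∘ (gt Y ∘ pb2 P).
Proof. by rewrite !compA -!arr_t -!compA pb_comm. Qed.

Let s : hom P P := pb_pair P pull_s_proof.
Let t : hom P P := pb_pair P pull_t_proof.

Lemma pull_st : s ∘ t = t.
Proof.
by apply: (pb_uniq P); rewrite compA ?pb_pair1 ?pb_pair2 -compA
  ?pb_pair1 ?pb_pair2 compA gst.
Qed.
Lemma pull_ts : t ∘ s = s.
Proof.
by apply: (pb_uniq P); rewrite compA ?pb_pair1 ?pb_pair2 -compA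
  ?pb_pair1 ?pb_pair2 compA gts.
Qed.

Lemma pull_P1 (W : A) (a b c : hom W P) : s ∘ a = s ∘ b -> t ∘ b = t ∘ c ->
  exists! φ : hom W P, fmap V φ = pt (fmap V a) (fmap V b) (fmap V c).
Proof.
move=> sab tbc.
have sab1 : gs X ∘ (pb1 P ∘ a) = gs X ∘ (pb1 P ∘ b).
  by rewrite !compA -(pb_pair1 P pull_s_proof) -!compA -/s sab.
have sab2 : gs Y ∘ (pb2 P ∘ a) = gs Y ∘ (pb2 P ∘ b).
  by rewrite !compA -(pb_pair2 P pull_s_proof) -!compA -/s sab.
have tbc1 : gt X ∘ (pb1 P ∘ b) = gt X ∘ (pb1 P ∘ c).
  by rewrite !compA -(pb_pair1 P pull_t_proof) -!compA -/t tbc.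
have tbc2 : gt Y ∘ (pb2 P ∘ b) = gt Y ∘ (pb2 P ∘ c).
  by rewrite !compA -(pb_pair2 P pull_t_proof) -!compA -/t tbc.
case: (gP1 sab1 tbc1) => x [hx _]; case: (gP1 sab2 tbc2) => y [hy _].
have xy : arr f ∘ x = arr g ∘ y.
  apply: faithV; rewrite !fmapM hx hy !pt_map -!fmapM.
  by rewrite !compA pb_comm.
exists (pb_pair P xy); split=> [|φ hφ].
  apply: (preserved_uniq presV); rewrite -fmapM pt_map -!fmapM.
  - by rewrite pb_pair1.
  - by rewrite pb_pair2.
apply: (pb_uniq P); rewrite ?pb_pair1 ?pb_pair2; apply: faithV.
- by rewrite fmapM hφ pt_map -!fmapM.
- by rewrite fmapM hφ pt_map -!fmapM.
Qed.

Definition pull_ob : gobj := GObj pull_st pull_ts pull_P1.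

Lemma pull_1s : gs X ∘ pb1 P = pb1 P ∘ s. Proof. by rewrite pb_pair1. Qed.
Lemma pull_1t : gt X ∘ pb1 P = pb1 P ∘ t. Proof. by rewrite pb_pair1. Qed.
Lemma pull_2s : gs Y ∘ pb2 P = pb2 P ∘ s. Proof. by rewrite pb_pair2. Qed.
Lemma pull_2t : gt Y ∘ pb2 P = pb2 P ∘ t. Proof. by rewrite pb_pair2. Qed.

Definition pull_1 : ghom pull_ob X := @GHom pull_ob X (pb1 P) pull_1s pull_1t.
Definition pull_2 : ghom pull_ob Y := @GHom pull_ob Y (pb2 P) pull_2s pull_2t.

Lemma pull_comm : ghom_comp f pull_1 = ghom_comp g pull_2.
Proof. by apply: ghom_eq; apply: pb_comm. Qed.

Section Pairing.
Context (W : gobj) (u : hom W X) (v : hom W Y) (h : arr f ∘ u = arr g ∘ v).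

Let w : hom W P := pb_pair P h.

Lemma pull_w1 : pb1 P ∘ w = u. Proof. exact: pb_pair1. Qed.
Lemma pull_w2 : pb2 P ∘ w = v. Proof. exact: pb_pair2. Qed.

Lemma pull_arr_s : gs X ∘ u = u ∘ gs W -> gs Y ∘ v = v ∘ gs W -> s ∘ w = w ∘ gs W.
Proof.
move=> hu hv; apply: (pb_uniq P); rewrite !compA -?pull_1s -?pull_2s.
- by rewrite pull_w1 -compA pull_w1.
- by rewrite pull_w2 -compA pull_w2.
Qed.
Lemma pull_arr_t : gt X ∘ u = u ∘ gt W -> gt Y ∘ v = v ∘ gt W -> t ∘ w = w ∘ gt W.
Proof.
move=> hu hv; apply: (pb_uniq P); rewrite !compA -?pull_1t -?pull_2t.
- by rewrite pull_w1 -compA pull_w1.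
- by rewrite pull_w2 -compA pull_w2.
Qed.
Lemma pull_carr_s : gs X ∘ u ∘ gs W = gs X ∘ u -> gs Y ∘ v ∘ gs W = gs Y ∘ v ->
  s ∘ w ∘ gs W = s ∘ w.
Proof.
move=> hu hv; apply: (pb_uniq P); rewrite !compA -?pull_1s -?pull_2s.
- by rewrite -!compA ![pb1 P ∘ _]compA pull_w1 compA.
- by rewrite -!compA ![pb2 P ∘ _]compA pull_w2 compA.
Qed.
Lemma pull_carr_t : gt X ∘ u ∘ gt W = gt X ∘ u -> gt Y ∘ v ∘ gt W = gt Y ∘ v ->
  t ∘ w ∘ gt W = t ∘ w.
Proof.
move=> hu hv; apply: (pb_uniq P); rewrite !compA -?pull_1t -?pull_2t.
- by rewrite -!compA ![pb1 P ∘ _]compA pull_w1 compA.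
- by rewrite -!compA ![pb2 P ∘ _]compA pull_w2 compA.
Qed.

End Pairing.

Lemma arr_comm (W : gobj) (u : ghom W X) (v : ghom W Y) :
  ghom_comp f u = ghom_comp g v -> arr f ∘ arr u = arr g ∘ arr v.
Proof. by move=> h; move: (f_equal (@arr _ _) h). Qed.

Lemma carr_comm (W : gobj) (u : gcell W X) (v : gcell W Y) :
  glwhisk f u = glwhisk g v -> arr f ∘ carr u = arr g ∘ carr v.
Proof. by move=> h; move: (f_equal (@carr _ _) h). Qed.

Definition pull_pair (W : gobj) (u : ghom W X) (v : ghom W Y)
  (h : ghom_comp f u = ghom_comp g v) : ghom W pull_ob :=
  @GHom W pull_ob (pb_pair P (arr_comm h))
    (pull_arr_s (arr_comm h) (arr_s u) (arr_s v))
    (pull_arr_t (arr_comm h) (arr_t u) (arr_t v)).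

Definition pull_cpair (W : gobj) (u : gcell W X) (v : gcell W Y)
  (h : glwhisk f u = glwhisk g v) : gcell W pull_ob :=
  @GCell W pull_ob (pb_pair P (carr_comm h))
    (pull_carr_s (carr_comm h) (carr_s u) (carr_s v))
    (pull_carr_t (carr_comm h) (carr_t u) (carr_t v)).

Definition pull1 : @pullback GA X Y Z f g.
Proof.
refine (@Pullback GA X Y Z f g pull_ob pull_1 pull_2 pull_comm pull_pair _ _ _).
- by move=> W u v h; apply: ghom_eq; apply: pb_pair1.
- by move=> W u v h; apply: ghom_eq; apply: pb_pair2.
- move=> W w w' h1 h2; apply: ghom_eq; apply: (pb_uniq P).
  + by move: (f_equal (@arr _ _) h1).
  + by move: (f_equal (@arr _ _) h2).
Defined.

Definition pull2 : @pullback2 GA X Y Z f g.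
Proof.
refine (@Pullback2 GA X Y Z f g pull1 pull_cpair _ _ _).
- by move=> W u v h; apply: gcell_eq; apply: pb_pair1.
- by move=> W u v h; apply: gcell_eq; apply: pb_pair2.
- move=> W w w' h1 h2; apply: gcell_eq; apply: (pb_uniq P).
  + by move: (f_equal (@carr _ _) h1).
  + by move: (f_equal (@carr _ _) h2).
Defined.

End Pullback.

(* Pullbacks of [GA], computed in [A]; [pullbacks GA] is thus inhabited. *)
Definition GA_pullbacks : pullbacks GA := pull2.

Definition Vhom (X Y : GA) (f : hom X Y) : hom (V (carrier X)) (V (carrier Y)) :=
  fmap V (arr f).
Definition Vcell (X Y : GA) (τ : cell X Y) : hom (V (carrier X)) (V (carrier Y)) :=
  fmap V (carr τ).
Definition vinv (X Y : GA) (τ : cell X Y) : cell X Y := gopp τ.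

Section Formulas.
Context (PB : pullbacks GA) (C0 C1 : GA) (d c : hom C1 C0) (e : hom C0 C1)
  (lam rho : cell C1 C1).

Definition mult_formula (m : hom (prod2 PB d c) C1) : Prop :=
  Vhom m = pt (Vhom (cdom rho ∘ pi2_1)) (Vhom (e ∘ d ∘ pi2_1))
              (Vhom (cdom lam ∘ pi2_2)).

Definition α1 : cell C1 C1 := vinv rho ▷ cdom rho.
Definition α2 : cell C1 C1 := vinv (cdom rho ◁ lam) • (lam ▷ cdom rho).
Definition α3 : cell C1 C1 := lam ▷ cdom lam.

Definition assoc_formula (α : cell (prod3 PB d c) C1) : Prop :=
  Vcell α = pt (Vcell (α1 ▷ pi3_1)) (Vcell (idc e ▷ d ▷ pi3_1))
              (pt (Vcell (α2 ▷ pi3_2)) (Vcell (idc e ▷ d ▷ pi3_2))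
                  (Vcell (α3 ▷ pi3_3))).

End Formulas.

End GA.

Arguments mult_formula {A B limA limB V faithV presV p} PB {C0 C1} d c e lam rho m.
Arguments assoc_formula {A B limA limB V faithV presV p} PB {C0 C1} d c e lam rho α.

(* Main.v *)
From mathcomp Require Import ssreflect ssrfun ssrbool.
Require Import Defs.

(** Write 1 for identity arrows, R = dom(ρ), L = dom(λ), and think of the arrows of
    C1 as elements.  A composable pair is an element of a pullback of two split
    epimorphisms, and the Mal'tsev identities give
      (x, y) = p((x, 1), (1, 1), (1, y)).
    Since p is natural, the image under V of a morphism or 2-cell out of the pullback
    is p of its values on the pairs (x, 1), (1, 1) and (1, y) ([Vcell_split]).  The
    same applies to triples and quadruples, one bracket at a time.  Hence a morphism
    or 2-cell is determined by its values on tuples with a single non-identity entry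
    ([cell2_ext], [cell3_ext], [cell4_ext]), and the formulas for m and α say exactly
    that m(x, 1) = R x, m(1, y) = L y and that α(x, 1, 1), α(1, y, 1), α(1, 1, z) are
    α1, α2, α3 ([mult_formulaP], [assoc_formulaP]).

    What remains is 2-category theory.  Each axiom of a pseudocategory is an equation
    between 2-cells out of a pullback, so it is equivalent to its restrictions to
    tuples with a single non-identity entry: the pentagon to four equations between
    2-cells C1 -> C1 ([pentagonP]) and the triangle to two ([triangleP]).  In a
    homogeneous pseudocategory the restricted triangle determines α(x, 1, 1) and
    α(1, 1, z), and one of the restricted pentagons determines α(1, y, 1), as in the
    proof that in a monoidal category the unit constraint at a tensor product is
    determined ([pseudocategory_restrictions]).  Conversely, if the restrictions are
    α1, α2, α3, then all the restricted equations are consequences of interchange and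
    of the invertibility of λ and ρ ([pseudocategory_of_restrictions]). *)

Set Implicit Arguments.
Unset Strict Implicit.
Unset Printing Implicit Defensive.
Local Open Scope cat_scope.

(** * Two-cells out of a pullback of split epimorphisms *)

(** The joint epimorphy that defines weakly Mal'tsev categories, for 2-cells
    instead of morphisms.  Of internal groupoids, the comparison of pseudocategories
    with their restrictions uses only this and the invertibility of 2-cells. *)
Definition cells_weakly_maltsev (K : two_category) : Prop :=
  forall (X Y Z : K) (f : hom X Y) (g : hom Z Y) (r : hom Y X) (s : hom Y Z)
    (fr : f ∘ r = idm Y) (gs : g ∘ s = idm Y) (P : pullback2 f g)
    (W : K) (κ κ' : cell P W),
  κ ▷ pb_pair P (split_left f gs) = κ' ▷ pb_pair P (split_left f gs) ->
  κ ▷ pb_pair P (split_right g fr) = κ' ▷ pb_pair P (split_right g fr) ->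
  κ = κ'.

(** * Vertical inverses *)

Section InverseCells.
Context (K : two_category).

Definition inverse_cells (X Y : K) (τ σ : cell X Y) : Prop :=
  [/\ cdom σ = ccod τ, ccod σ = cdom τ,
      σ • τ = idc (cdom τ) & τ • σ = idc (ccod τ)].

Lemma idc_inj (X Y : K) (f g : hom X Y) : idc f = idc g -> f = g.
Proof. by move=> h; rewrite -(cdom_idc f) h cdom_idc. Qed.

Lemma vcomp_idl (X Y : K) (f : hom X Y) (τ : cell X Y) :
  ccod τ = f -> idc f • τ = τ.
Proof. by move=> <-; apply: vcomp1c. Qed.

Lemma vcomp_idr (X Y : K) (f : hom X Y) (τ : cell X Y) :
  cdom τ = f -> τ • idc f = τ.
Proof. by move=> <-; apply: vcompc1. Qed.

Lemma inverse_lwhisk (X Y Z : K) (v : hom Y Z) (τ σ : cell X Y) :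
  inverse_cells τ σ -> inverse_cells (v ◁ τ) (v ◁ σ).
Proof.
case=> h1 h2 h3 h4; split; rewrite ?cdom_lwhisk ?ccod_lwhisk ?h1 ?h2 //.
- by rewrite -lwhisk_vcomp // h3 lwhisk_idc.
- by rewrite -lwhisk_vcomp // h4 lwhisk_idc.
Qed.

Lemma inverse_rwhisk (X Y Z : K) (τ σ : cell Y Z) (u : hom X Y) :
  inverse_cells τ σ -> inverse_cells (τ ▷ u) (σ ▷ u).
Proof.
case=> h1 h2 h3 h4; split; rewrite ?cdom_rwhisk ?ccod_rwhisk ?h1 ?h2 //.
- by rewrite -rwhisk_vcomp // h3 rwhisk_idc.
- by rewrite -rwhisk_vcomp // h4 rwhisk_idc.
Qed.

Lemma inverse_idc (X Y : K) (f : hom X Y) : inverse_cells (idc f) (idc f).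
Proof. by split; rewrite ?cdom_idc ?ccod_idc // vcomp_idl ?ccod_idc. Qed.

Lemma vcomp_solve (X Y : K) (τ σ κ υ : cell X Y) :
  inverse_cells τ σ -> cdom τ = ccod κ -> τ • κ = υ -> κ = σ • υ.
Proof.
case=> h1 h2 h3 h4 hκ <-; rewrite vcompA // h3 vcomp_idl //.
Qed.

Lemma vcomp_cancel (X Y : K) (τ σ κ κ' : cell X Y) :
  inverse_cells τ σ -> cdom τ = ccod κ -> cdom τ = ccod κ' ->
  τ • κ = τ • κ' -> κ = κ'.
Proof.
move=> i h h' eq; rewrite (vcomp_solve i h eq).
by rewrite -(vcomp_solve i h' erefl).
Qed.

Lemma vcomp_cancelr (X Y : K) (τ σ κ κ' : cell X Y) :
  inverse_cells τ σ -> ccod τ = cdom κ -> ccod τ = cdom κ' ->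
  κ • τ = κ' • τ -> κ = κ'.
Proof.
case=> h1 h2 h3 h4 h h' eq.
by rewrite -(vcomp_idr (esym h)) -(vcomp_idr (esym h')) -h4 !vcompA ?eq.
Qed.

Lemma inverse_uniq (X Y : K) (τ σ σ' : cell X Y) :
  inverse_cells τ σ -> inverse_cells τ σ' -> σ = σ'.
Proof.
move=> i i'; have [h1 h2 h3 h4] := i; have [h1' h2' h3' h4'] := i'.
by apply: (vcomp_cancel i); rewrite ?h2 ?h2' // h4 h4'.
Qed.

(** Interchange of τ with itself reads τ • (τ F) = τ • (F τ) for F the domain of τ,
    and τ cancels: Kelly's argument for unit constraints. *)
Lemma rwhisk_dom (X : K) (τ τ' : cell X X) : inverse_cells τ τ' ->
  ccod τ = idm X -> τ ▷ cdom τ = cdom τ ◁ τ.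
Proof.
move=> i h; apply: (vcomp_cancel i).
- by rewrite ccod_rwhisk h comp1m.
- by rewrite ccod_lwhisk h compm1.
by move: (interchange τ τ); rewrite h rwhisk1 lwhisk1 => ->.
Qed.

(** Whiskering with a morphism isomorphic to the identity loses nothing, since the
    isomorphism transports κ F back to κ by naturality. *)
Lemma rwhisk_iso_faithful (X Y : K) (τ τ' : cell X X) (κ κ' : cell X Y) :
  inverse_cells τ τ' -> ccod τ = idm X ->
  cdom κ = cdom κ' -> ccod κ = ccod κ' ->
  κ ▷ cdom τ = κ' ▷ cdom τ -> κ = κ'.
Proof.
move=> i h hd hc eq; apply: (vcomp_cancelr (inverse_lwhisk (cdom κ) i)).
- by rewrite ccod_lwhisk h compm1.
- by rewrite ccod_lwhisk h compm1.
have := interchange κ τ; have := interchange κ' τ.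
by rewrite h !rwhisk1 -hd -hc -eq => <- <-.
Qed.

End InverseCells.

(** The two injections characterized by their projections, so that they need not
    be presented as pairs. *)
Lemma split_ext (K : two_category) (wm : cells_weakly_maltsev K) (X Y Z : K)
  (f : hom X Y) (g : hom Z Y) (r : hom Y X) (s : hom Y Z)
  (P : pullback2 f g) (i : hom X P) (j : hom Z P) :
  f ∘ r = idm Y -> g ∘ s = idm Y ->
  pb1 P ∘ i = idm X -> pb2 P ∘ i = s ∘ f ->
  pb1 P ∘ j = r ∘ g -> pb2 P ∘ j = idm Z ->
  forall (W : K) (κ κ' : cell P W), κ ▷ i = κ' ▷ i -> κ ▷ j = κ' ▷ j -> κ = κ'.
Proof.
move=> fr gs i1 i2 j1 j2 W κ κ' hi hj; apply: (wm _ _ _ f g r s fr gs P).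
- by rewrite (_ : pb_pair _ _ = i) //; apply: (pb_uniq P);
    rewrite ?pb_pair1 ?pb_pair2 ?i1 ?i2.
- by rewrite (_ : pb_pair _ _ = j) //; apply: (pb_uniq P);
    rewrite ?pb_pair1 ?pb_pair2 ?j1 ?j2.
Qed.

(** * Composable pairs, triples and quadruples with at most one non-identity entry *)

Section Tuples.
Context (K : two_category) (PB : pullbacks K) (C0 C1 : K)
  (d c : hom C1 C0) (e : hom C0 C1).
Local Notation P2 := (prod2 PB d c).
Local Notation P3 := (prod3 PB d c).
Local Notation P4 := (prod4 PB d c).
Local Notation p4_1 := (pi4_1 PB d c).
Local Notation p4_2 := (pi4_2 PB d c).
Local Notation p4_3 := (pi4_3 PB d c).
Local Notation p4_4 := (pi4_4 PB d c).

Lemma prod2_ext (W : K) (w w' : hom W P2) :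
  pi2_1 ∘ w = pi2_1 ∘ w' -> pi2_2 ∘ w = pi2_2 ∘ w' -> w = w'.
Proof. exact: (pb_uniq P2). Qed.

Lemma prod3_ext (W : K) (w w' : hom W P3) :
  pi3_1 ∘ w = pi3_1 ∘ w' -> pi3_2 ∘ w = pi3_2 ∘ w' ->
  pi3_3 ∘ w = pi3_3 ∘ w' -> w = w'.
Proof.
rewrite /pi3_2 /pi3_3 -!compA => h1 h2 h3.
by apply: (pb_uniq P3) => //; apply: prod2_ext.
Qed.

Lemma pair2_1 (W : K) (x y : hom W C1) (xy : d ∘ x = c ∘ y) :
  pi2_1 ∘ pair2 PB xy = x.
Proof. exact: pb_pair1. Qed.
Lemma pair2_2 (W : K) (x y : hom W C1) (xy : d ∘ x = c ∘ y) :
  pi2_2 ∘ pair2 PB xy = y.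
Proof. exact: pb_pair2. Qed.
Lemma pair3_1 (W : K) (x y z : hom W C1) (xy : d ∘ x = c ∘ y)
  (yz : d ∘ y = c ∘ z) : pi3_1 ∘ pair3 PB xy yz = x.
Proof. exact: pb_pair1. Qed.
Lemma pair3_2 (W : K) (x y z : hom W C1) (xy : d ∘ x = c ∘ y)
  (yz : d ∘ y = c ∘ z) : pi3_2 ∘ pair3 PB xy yz = y.
Proof. by rewrite /pi3_2 -compA pb_pair2 pair2_1. Qed.
Lemma pair3_3 (W : K) (x y z : hom W C1) (xy : d ∘ x = c ∘ y)
  (yz : d ∘ y = c ∘ z) : pi3_3 ∘ pair3 PB xy yz = z.
Proof. by rewrite /pi3_3 -compA pb_pair2 pair2_2. Qed.

Lemma tail3_1 : pi2_1 ∘ pb2 P3 = pi3_2. Proof. by []. Qed.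
Lemma tail3_2 : pi2_2 ∘ pb2 P3 = pi3_3. Proof. by []. Qed.
Lemma tail4_1 : pi3_1 ∘ pb2 P4 = p4_2. Proof. by []. Qed.
Lemma tail4_2 : pi3_2 ∘ pb2 P4 = p4_3. Proof. by []. Qed.
Lemma tail4_3 : pi3_3 ∘ pb2 P4 = p4_4. Proof. by []. Qed.

Definition tupE := (pair2_1, pair2_2, pair3_1, pair3_2, pair3_3,
  tail3_1, tail3_2, tail4_1, tail4_2, tail4_3).

(** Turns a computation of g f into one of g (f w), for the reassociated versions
    of the projection rules. *)
Lemma rew_comp (X Y Z W : K) (g : hom Y Z) (f : hom X Y) (h : hom X Z)
  (w : hom W X) : g ∘ f = h -> g ∘ (f ∘ w) = h ∘ w.
Proof. by rewrite compA => ->. Qed.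

Definition tuprE := (fun W X x y xy (w : hom X W) => rew_comp w (@pair2_1 W x y xy),
  fun W X x y xy (w : hom X W) => rew_comp w (@pair2_2 W x y xy),
  fun W X x y z xy yz (w : hom X W) => rew_comp w (@pair3_1 W x y z xy yz),
  fun W X x y z xy yz (w : hom X W) => rew_comp w (@pair3_2 W x y z xy yz),
  fun W X x y z xy yz (w : hom X W) => rew_comp w (@pair3_3 W x y z xy yz),
  (fun X (w : hom X _) => rew_comp w tail3_1,
  fun X (w : hom X _) => rew_comp w tail3_2),
  (fun X (w : hom X _) => rew_comp w tail4_1,
  fun X (w : hom X _) => rew_comp w tail4_2,
  fun X (w : hom X _) => rew_comp w tail4_3)).

Hypotheses (wm : cells_weakly_maltsev K).
Hypotheses (de : d ∘ e = idm C0) (ce : c ∘ e = idm C0).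

Lemma deK (W : K) (x : hom W C0) : d ∘ (e ∘ x) = x.
Proof. by rewrite compA de comp1m. Qed.
Lemma ceK (W : K) (x : hom W C0) : c ∘ (e ∘ x) = x.
Proof. by rewrite compA ce comp1m. Qed.

Lemma in_dd : d ∘ (e ∘ d) = c ∘ (e ∘ d). Proof. by rewrite deK ceK. Qed.
Lemma in_cc : d ∘ (e ∘ c) = c ∘ (e ∘ c). Proof. by rewrite deK ceK. Qed.

Local Notation i1 := (e1 PB d ce).
Local Notation i2 := (e2 PB c de).

(** On elements, the triples (x, 1, 1), (1, y, 1) and (1, 1, z) with identity arrows
    1 where composability requires them; [e1] and [e2] are the same for pairs. *)
Definition in3_1 : hom C1 P3 := pair3 PB (e1_proof d ce) in_dd.
Definition in3_2 : hom C1 P3 := pair3 PB (e2_proof c de) (e1_proof d ce).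
Definition in3_3 : hom C1 P3 := pair3 PB in_cc (e2_proof c de).

Lemma in4_1_proof : d ∘ idm C1 = c ∘ pb1 P3 ∘ (in3_1 ∘ (e ∘ d)).
Proof. by rewrite -compA (rew_comp _ (pair3_1 _ _)) comp1m ceK compm1. Qed.
Lemma in4_proof (x : hom C1 P3) : d ∘ (e ∘ (c ∘ (pi3_1 ∘ x))) = c ∘ pb1 P3 ∘ x.
Proof. by rewrite deK compA. Qed.

(** The quadruples (x, 1, 1, 1), and (1, y, z, w) for a triple (y, z, w) built out
    of one arrow.  The quadruple injections are [in4_1] and the [in4_tail] of the
    three injections into triples. *)
Definition in4_1 : hom C1 P4 := pb_pair P4 in4_1_proof.
Definition in4_tail (x : hom C1 P3) : hom C1 P4 := pb_pair P4 (in4_proof x).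

Lemma in4_1_1 : p4_1 ∘ in4_1 = idm C1.
Proof. exact: pb_pair1. Qed.
Lemma in4_1_tail : pb2 P4 ∘ in4_1 = in3_1 ∘ (e ∘ d).
Proof. exact: pb_pair2. Qed.
Lemma in4_tail_1 (x : hom C1 P3) : p4_1 ∘ in4_tail x = e ∘ (c ∘ (pi3_1 ∘ x)).
Proof. exact: pb_pair1. Qed.
Lemma in4_tail_tail (x : hom C1 P3) : pb2 P4 ∘ in4_tail x = x.
Proof. exact: pb_pair2. Qed.

Lemma cell2_ext (W : K) (κ κ' : cell P2 W) :
  κ ▷ i1 = κ' ▷ i1 -> κ ▷ i2 = κ' ▷ i2 -> κ = κ'.
Proof.
by apply: (split_ext wm de ce); rewrite ?pair2_1 ?pair2_2.
Qed.

Lemma in3_tail_proof : d ∘ (e ∘ (c ∘ pi2_1)) = (c ∘ pb1 P2) ∘ idm P2.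
Proof. by rewrite deK compm1. Qed.

(** The triple (1, y, z); with [in3_1] it exhibits C1 x (C1 x C1) as a pullback of
    split epimorphisms. *)
Definition in3_tail : hom P2 P3 := pb_pair P3 in3_tail_proof.

Lemma in3_tail_1 : in3_tail ∘ i1 = in3_2.
Proof.
apply: (pb_uniq P3); rewrite compA ?pb_pair1 ?pb_pair2.
  by rewrite -!compA pair2_1 compm1.
by rewrite comp1m; apply: prod2_ext; rewrite !tupE.
Qed.

Lemma in3_tail_2 : in3_tail ∘ i2 = in3_3.
Proof.
apply: (pb_uniq P3); rewrite compA ?pb_pair1 ?pb_pair2.
  by rewrite -!compA pair2_1 ceK.
by rewrite comp1m; apply: prod2_ext; rewrite !tupE.
Qed.

Lemma in3_1_tail : pb2 P3 ∘ in3_1 = i1 ∘ e ∘ d.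
Proof.
rewrite pb_pair2; apply: prod2_ext;
  rewrite tupE -!compA ?(rew_comp _ (pair2_1 _)) ?(rew_comp _ (pair2_2 _)) ?comp1m //.
by rewrite -compA deK.
Qed.

(** A triple (x, (y, z)) is p of (x, 1, 1), (1, 1, 1) and (1, y, z), and then the pair
    (y, z) is decomposed in turn. *)
Lemma cell3_ext (W : K) (κ κ' : cell P3 W) :
  κ ▷ in3_1 = κ' ▷ in3_1 -> κ ▷ in3_2 = κ' ▷ in3_2 ->
  κ ▷ in3_3 = κ' ▷ in3_3 -> κ = κ'.
Proof.
move=> h1 h2 h3.
apply: (split_ext (P := P3) (i := in3_1) (j := in3_tail) (r := e) (s := i1 ∘ e) wm) => //.
- by rewrite -compA (rew_comp _ (pair2_1 _)) comp1m.
- exact: pair3_1.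
- exact: in3_1_tail.
- by rewrite pb_pair1.
- by rewrite pb_pair2.
- by apply: cell2_ext; rewrite -!rwhiskA ?in3_tail_1 ?in3_tail_2.
Qed.

Lemma cell4_ext (W : K) (κ κ' : cell P4 W) :
  κ ▷ in4_1 = κ' ▷ in4_1 -> κ ▷ in4_tail in3_1 = κ' ▷ in4_tail in3_1 ->
  κ ▷ in4_tail in3_2 = κ' ▷ in4_tail in3_2 ->
  κ ▷ in4_tail in3_3 = κ' ▷ in4_tail in3_3 -> κ = κ'.
Proof.
have hj : d ∘ (e ∘ (c ∘ pi3_1)) = (c ∘ pb1 P3) ∘ idm P3 by rewrite deK compm1.
pose j : hom P3 P4 := pb_pair P4 hj.
have jE x : j ∘ x = in4_tail x.
  apply: (pb_uniq P4); rewrite ?pb_pair1 ?pb_pair2 compA ?pb_pair1 ?pb_pair2.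
    by rewrite -!compA.
  by rewrite comp1m.
move=> h1 h2 h3 h4.
apply: (split_ext (P := P4) (i := in4_1) (j := j) (r := e) (s := in3_1 ∘ e) wm) => //.
- by rewrite -compA (rew_comp _ (pair3_1 _ _)) comp1m.
- exact: pb_pair1.
- by rewrite pb_pair2 compA.
- by rewrite pb_pair1.
- by rewrite pb_pair2.
- by apply: cell3_ext; rewrite -!rwhiskA ?jE.
Qed.

Lemma hom2_ext (W : K) (f f' : hom P2 W) :
  f ∘ i1 = f' ∘ i1 -> f ∘ i2 = f' ∘ i2 -> f = f'.
Proof.
by move=> h1 h2; apply: idc_inj; apply: cell2_ext; rewrite !rwhisk_idc ?h1 ?h2.
Qed.

Lemma hom3_ext (W : K) (f f' : hom P3 W) :
  f ∘ in3_1 = f' ∘ in3_1 -> f ∘ in3_2 = f' ∘ in3_2 ->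
  f ∘ in3_3 = f' ∘ in3_3 -> f = f'.
Proof.
by move=> h1 h2 h3; apply: idc_inj; apply: cell3_ext;
  rewrite !rwhisk_idc ?h1 ?h2 ?h3.
Qed.

End Tuples.

(** * Coherence axioms restricted to one variable *)

Section Restriction.
Context (K : two_category) (wm : cells_weakly_maltsev K) (PB : pullbacks K)
  (C0 C1 : K) (d c : hom C1 C0) (e : hom C0 C1).
Hypotheses (de : d ∘ e = idm C0) (ce : c ∘ e = idm C0).
Local Notation P2 := (prod2 PB d c).
Local Notation P3 := (prod3 PB d c).
Local Notation P4 := (prod4 PB d c).
Local Notation p4_1 := (pi4_1 PB d c).
Local Notation p4_2 := (pi4_2 PB d c).
Local Notation p4_3 := (pi4_3 PB d c).
Local Notation p4_4 := (pi4_4 PB d c).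
Local Notation i1 := (e1 PB d ce).
Local Notation i2 := (e2 PB c de).
Local Notation j1 := (in3_1 PB de ce).
Local Notation j2 := (in3_2 PB de ce).
Local Notation j3 := (in3_3 PB de ce).
Local Notation k1 := (in4_1 PB de ce).
Local Notation kt := (@in4_tail _ PB _ _ d c e de).

Context (m : hom P2 C1) (α : cell P3 C1).
Local Notation R := (m ∘ i1).
Local Notation L := (m ∘ i2).
Local Notation A1 := (α ▷ j1).
Local Notation A2 := (α ▷ j2).
Local Notation A3 := (α ▷ j3).

(** R and L are m(-, 1) and m(1, -), while A1, A2, A3 are α(-, 1, 1), α(1, -, 1) and
    α(1, 1, -).  A pair is recognized as (x, 1) by its projections alone, so that
    the way in which it was formed does not matter. *)
Lemma hom_right (W : K) (w : hom W P2) (x : hom W C1) :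
  pi2_1 ∘ w = x -> pi2_2 ∘ w = e ∘ (d ∘ x) -> m ∘ w = R ∘ x.
Proof.
move=> h1 h2; rewrite -compA; congr (m ∘ _).
by apply: prod2_ext; rewrite ?h1 ?h2 !tuprE ?comp1m // compA.
Qed.

Lemma hom_left (W : K) (w : hom W P2) (y : hom W C1) :
  pi2_1 ∘ w = e ∘ (c ∘ y) -> pi2_2 ∘ w = y -> m ∘ w = L ∘ y.
Proof.
move=> h1 h2; rewrite -compA; congr (m ∘ _).
by apply: prod2_ext; rewrite ?h1 ?h2 !tuprE ?comp1m // compA.
Qed.

Lemma cell_right (W : K) (κ : cell W P2) (σ : cell W C1) :
  pi2_1 ◁ κ = σ -> pi2_2 ◁ κ = (e ∘ d) ◁ σ -> m ◁ κ = R ◁ σ.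
Proof.
move=> h1 h2; rewrite lwhiskA; congr (m ◁ _).
apply: (pb_cuniq (p := P2)); rewrite -!lwhiskA -/pi2_1 -/pi2_2 ?h1 ?h2.
  by rewrite [_ ∘ i1]pair2_1 lwhisk1.
by rewrite [_ ∘ i1]pair2_2.
Qed.

Lemma cell_left (W : K) (κ : cell W P2) (σ : cell W C1) :
  pi2_1 ◁ κ = (e ∘ c) ◁ σ -> pi2_2 ◁ κ = σ -> m ◁ κ = L ◁ σ.
Proof.
move=> h1 h2; rewrite lwhiskA; congr (m ◁ _).
apply: (pb_cuniq (p := P2)); rewrite -!lwhiskA -/pi2_1 -/pi2_2 ?h1 ?h2.
  by rewrite [_ ∘ i2]pair2_1.
by rewrite [_ ∘ i2]pair2_2 lwhisk1.
Qed.

Lemma assoc_left (W : K) (w : hom W P3) (x : hom W C1) :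
  pi3_1 ∘ w = x -> pi3_2 ∘ w = e ∘ (d ∘ x) -> pi3_3 ∘ w = e ∘ (d ∘ x) ->
  α ▷ w = A1 ▷ x.
Proof.
move=> h1 h2 h3; rewrite -rwhiskA; congr (α ▷ _).
by apply: prod3_ext; rewrite ?h1 ?h2 ?h3 !tuprE ?comp1m // compA.
Qed.

Lemma unit_unit : i2 ∘ e = i1 ∘ e.
Proof. by apply: prod2_ext; rewrite !tuprE -!compA ?de ?ce comp1m ?compm1. Qed.

Hypotheses (dm : d ∘ m = d ∘ pi2_2) (cm : c ∘ m = c ∘ pi2_1).

Lemma d_right : d ∘ R = d.
Proof. by rewrite compA dm -compA pair2_2 compA de comp1m. Qed.
Lemma c_right : c ∘ R = c.
Proof. by rewrite compA cm -compA pair2_1 compm1. Qed.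
Lemma d_left : d ∘ L = d.
Proof. by rewrite compA dm -compA pair2_2 compm1. Qed.
Lemma c_left : c ∘ L = c.
Proof. by rewrite compA cm -compA pair2_1 compA ce comp1m. Qed.

(* A consequence of homogeneity: e = dom(ρ e) = dom(ρ) e = R e. *)
Hypothesis (unit : R ∘ e = e).

Lemma unit_left : L ∘ e = e.
Proof. by rewrite -compA unit_unit compA. Qed.

(** These evaluate m(x, y) and m(y, z), the inner composites of both bracketings of a
    triple, when a single entry is not an identity. *)
Lemma m12_in3_1 : m ∘ (pair2 PB (comm3_12 PB d c) ∘ j1) = R.
Proof.
by rewrite (@hom_right _ _ (idm C1)) ?compm1 // ?tuprE ?tupE.
Qed.
Lemma m12_in3_2 : m ∘ (pair2 PB (comm3_12 PB d c) ∘ j2) = L.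
Proof. by rewrite (@hom_left _ _ (idm C1)) ?compm1 // ?tuprE ?tupE. Qed.
Lemma m12_in3_3 : m ∘ (pair2 PB (comm3_12 PB d c) ∘ j3) = e ∘ c.
Proof.
by rewrite (@hom_left _ _ (e ∘ c)) ?tuprE ?tupE ?(ceK ce) // compA unit_left.
Qed.
Lemma m23_in3_1 : m ∘ (pair2 PB (comm3_23 PB d c) ∘ j1) = e ∘ d.
Proof.
by rewrite (@hom_right _ _ (e ∘ d)) ?tuprE ?tupE ?(deK de) // compA unit.
Qed.
Lemma m23_in3_2 : m ∘ (pair2 PB (comm3_23 PB d c) ∘ j2) = R.
Proof.
by rewrite (@hom_right _ _ (idm C1)) ?compm1 // ?tuprE ?tupE.
Qed.
Lemma m23_in3_3 : m ∘ (pair2 PB (comm3_23 PB d c) ∘ j3) = L.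
Proof.
by rewrite (@hom_left _ _ (idm C1)) ?compm1 // ?tuprE ?tupE.
Qed.

(** The bracketings m(x, m(y, z)) and m(m(x, y), z) in one variable; these are the
    domains and codomains that A1, A2 and A3 have to have. *)
Lemma hom_one_m_1 : m ∘ one_m cm ∘ j1 = R.
Proof.
rewrite -compA (@hom_right _ _ (idm C1)) ?compm1 // ?tuprE ?tupE //.
by rewrite /mul -compA m23_in3_1.
Qed.
Lemma hom_one_m_2 : m ∘ one_m cm ∘ j2 = L ∘ R.
Proof.
rewrite -compA; apply: hom_left; rewrite ?tuprE ?tupE ?c_right //.
by rewrite /mul -compA m23_in3_2.
Qed.
Lemma hom_one_m_3 : m ∘ one_m cm ∘ j3 = L ∘ L.
Proof.
rewrite -compA; apply: hom_left; rewrite ?tuprE ?tupE ?c_left //.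
by rewrite /mul -compA m23_in3_3.
Qed.
Lemma hom_m_one_1 : m ∘ m_one dm ∘ j1 = R ∘ R.
Proof.
rewrite -compA; apply: hom_right; rewrite ?tuprE ?tupE ?d_right //.
by rewrite /mul -compA m12_in3_1.
Qed.
Lemma hom_m_one_2 : m ∘ m_one dm ∘ j2 = R ∘ L.
Proof.
rewrite -compA; apply: hom_right; rewrite ?tuprE ?tupE ?d_left //.
by rewrite /mul -compA m12_in3_2.
Qed.
Lemma hom_m_one_3 : m ∘ m_one dm ∘ j3 = L.
Proof.
rewrite -compA (@hom_left _ _ (idm C1)) ?compm1 // ?tuprE ?tupE //.
by rewrite /mul -compA m12_in3_3.
Qed.

Lemma hom_mid_unit_1 : mid_unit PB de ce ∘ i1 = j1.
Proof.
by apply: prod3_ext; rewrite ?tuprE [RHS]tupE -?compA ?tupE ?compm1.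
Qed.
Lemma hom_mid_unit_2 : mid_unit PB de ce ∘ i2 = j3.
Proof.
by apply: prod3_ext; rewrite ?tuprE [RHS]tupE -?compA ?tupE ?compm1 ?(deK de).
Qed.

Lemma proj4_tail (x : hom C1 P3) :
  [/\ p4_1 ∘ kt x = e ∘ (c ∘ (pi3_1 ∘ x)), p4_2 ∘ kt x = pi3_1 ∘ x,
      p4_3 ∘ kt x = pi3_2 ∘ x & p4_4 ∘ kt x = pi3_3 ∘ x].
Proof.
split; first exact: in4_tail_1.
- by rewrite -tail4_1 -compA in4_tail_tail.
- by rewrite -tail4_2 -compA in4_tail_tail.
- by rewrite -tail4_3 -compA in4_tail_tail.
Qed.

Lemma proj4_head :
  [/\ p4_1 ∘ k1 = idm C1, p4_2 ∘ k1 = e ∘ d, p4_3 ∘ k1 = e ∘ d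
    & p4_4 ∘ k1 = e ∘ d].
Proof.
split; first exact: in4_1_1.
- by rewrite -tail4_1 -compA in4_1_tail tuprE comp1m.
- by rewrite -tail4_2 -compA in4_1_tail tuprE -compA (deK de).
- by rewrite -tail4_3 -compA in4_1_tail tuprE -compA (deK de).
Qed.

Section Pentagon.
Hypotheses (dα : d ◁ α = idc (d ∘ pi3_3)) (cα : c ◁ α = idc (c ∘ pi3_1)).
Hypothesis Aunit : A1 ▷ e = idc e.

Lemma d_assoc (x : hom C1 P3) : d ◁ (α ▷ x) = idc (d ∘ (pi3_3 ∘ x)).
Proof. by rewrite -lrwhiskA dα rwhisk_idc -compA. Qed.
Lemma c_assoc (x : hom C1 P3) : c ◁ (α ▷ x) = idc (c ∘ (pi3_1 ∘ x)).
Proof. by rewrite -lrwhiskA cα rwhisk_idc -compA. Qed.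

(** The five 2-cells of the pentagon at the quadruple (x, 1, 1, 1). *)
Lemma assoc_m_one_one_head : α ▷ m_one_one dm ▷ k1 = A1 ▷ R.
Proof.
have [h1 h2 h3 h4] := proj4_head.
rewrite -rwhiskA; apply: assoc_left; rewrite tuprE ?h3 ?h4.
- by rewrite /mul -compA (@hom_right _ _ (idm C1)) ?compm1 // tuprE.
- by rewrite d_right.
- by rewrite d_right.
Qed.

Lemma assoc_one_one_m_head : α ▷ one_one_m cm ▷ k1 = A1.
Proof.
have [h1 h2 h3 h4] := proj4_head.
rewrite -rwhiskA -[RHS]rwhisk1; apply: assoc_left; rewrite tuprE ?compm1 //.
rewrite /mul -compA (@hom_right _ _ (e ∘ d)) ?tuprE ?(deK de) //.
by rewrite compA unit.
Qed.

Lemma assoc_one_m_one_head : α ▷ one_m_one dm cm ▷ k1 = A1.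
Proof.
have [h1 h2 h3 h4] := proj4_head.
rewrite -rwhiskA -[RHS]rwhisk1; apply: assoc_left; rewrite tuprE ?compm1 //.
rewrite /mul -compA (@hom_right _ _ (e ∘ d)) ?tuprE ?(deK de) //.
by rewrite compA unit.
Qed.

Lemma α_one_head : m ◁ α_one dα ▷ k1 = R ◁ A1.
Proof.
have [h1 h2 h3 h4] := proj4_head.
rewrite lrwhiskA; apply: cell_right.
- rewrite -lrwhiskA pb_cpair1 -rwhiskA -[RHS]rwhisk1.
  by apply: assoc_left; rewrite tuprE ?compm1.
- by rewrite -lrwhiskA pb_cpair2 rwhisk_idc h4 lwhiskA (d_assoc j1) tupE
    (deK de) lwhisk_idc.
Qed.

Lemma one_α_head : m ◁ one_α cα ▷ k1 = idc R.
Proof.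
rewrite lrwhiskA (@cell_right _ _ (idc (idm C1))) ?lwhisk_idc ?compm1 //.
- rewrite -lrwhiskA pb_cpair1 rwhisk_idc.
  by rewrite in4_1_1.
- rewrite -lrwhiskA pb_cpair2 -!rwhiskA in4_1_tail rwhiskA.
  by rewrite rwhiskA Aunit rwhisk_idc.
Qed.

(** The five 2-cells of the pentagon at (1, y, z, w).  Four of them are computed for
    every triple (y, z, w) built out of one arrow. *)
Lemma assoc_m_one_one_tail (x y : hom C1 P3) :
  pi3_1 ∘ y = L ∘ (pi3_1 ∘ x) -> pi3_2 ∘ y = pi3_2 ∘ x ->
  pi3_3 ∘ y = pi3_3 ∘ x ->
  α ▷ m_one_one dm ▷ kt x = α ▷ y.
Proof.
have [h1 h2 h3 h4] := proj4_tail x => y1 y2 y3.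
rewrite -rwhiskA; congr (α ▷ _).
apply: prod3_ext; rewrite tuprE ?h3 ?h4 ?y1 ?y2 ?y3 //.
by rewrite /mul -compA; apply: hom_left; rewrite tuprE.
Qed.

Lemma assoc_one_one_m_tail (x y : hom C1 P3) :
  pi3_1 ∘ y = e ∘ (c ∘ (pi3_1 ∘ x)) -> pi3_2 ∘ y = pi3_1 ∘ x ->
  pi3_3 ∘ y = m ∘ (pair2 PB (comm3_23 PB d c) ∘ x) ->
  α ▷ one_one_m cm ▷ kt x = α ▷ y.
Proof.
have [h1 h2 h3 h4] := proj4_tail x => y1 y2 y3.
rewrite -rwhiskA; congr (α ▷ _).
apply: prod3_ext; rewrite tuprE ?h1 ?h2 ?y1 ?y2 ?y3 //.
rewrite /mul -compA; congr (m ∘ _); apply: prod2_ext; rewrite !tuprE //.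
Qed.

Lemma assoc_one_m_one_tail (x y : hom C1 P3) :
  pi3_1 ∘ y = e ∘ (c ∘ (pi3_1 ∘ x)) ->
  pi3_2 ∘ y = m ∘ (pair2 PB (comm3_12 PB d c) ∘ x) ->
  pi3_3 ∘ y = pi3_3 ∘ x ->
  α ▷ one_m_one dm cm ▷ kt x = α ▷ y.
Proof.
have [h1 h2 h3 h4] := proj4_tail x => y1 y2 y3.
rewrite -rwhiskA; congr (α ▷ _).
apply: prod3_ext; rewrite tuprE ?h1 ?h4 ?y1 ?y2 ?y3 //.
rewrite /mul -compA; congr (m ∘ _); apply: prod2_ext; rewrite !tuprE //.
Qed.

Lemma one_α_tail (x : hom C1 P3) : m ◁ one_α cα ▷ kt x = L ◁ (α ▷ x).
Proof.
have [h1 h2 h3 h4] := proj4_tail x.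
rewrite lrwhiskA; apply: cell_left.
- by rewrite -lrwhiskA pb_cpair1 rwhisk_idc h1 lwhiskA c_assoc lwhisk_idc.
- by rewrite -lrwhiskA pb_cpair2 -!rwhiskA in4_tail_tail.
Qed.

Lemma α_one_tail (x y : hom C1 P3) :
  pi3_1 ∘ y = e ∘ (c ∘ (pi3_1 ∘ x)) -> pi3_2 ∘ y = pi3_1 ∘ x ->
  pi3_3 ∘ y = pi3_2 ∘ x -> pi3_3 ∘ x = e ∘ d ->
  d ∘ (pi3_2 ∘ x) = d ->
  m ◁ α_one dα ▷ kt x = R ◁ (α ▷ y).
Proof.
have [h1 h2 h3 h4] := proj4_tail x => y1 y2 y3 x3 x2.
rewrite lrwhiskA; apply: cell_right.
- rewrite -lrwhiskA pb_cpair1 -!rwhiskA; congr (α ▷ _).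
  by apply: prod3_ext; rewrite tuprE ?h1 ?h2 ?h3 ?y1 ?y2 ?y3.
- rewrite -lrwhiskA pb_cpair2 rwhisk_idc h4 x3 lwhiskA d_assoc lwhisk_idc.
  by rewrite y3 x2.
Qed.

(** At (1, 1, 1, w) the 2-cell α(1, 1, 1) is an identity. *)
Lemma α_one_tail_3 : m ◁ α_one dα ▷ kt j3 = idc L.
Proof.
have [h1 h2 h3 h4] := proj4_tail j3.
rewrite lrwhiskA (@cell_left _ _ (idc (idm C1))) ?lwhisk_idc ?compm1 //.
- rewrite -lrwhiskA pb_cpair1 -!rwhiskA.
  rewrite (@assoc_left _ _ (e ∘ c)) ?tuprE ?h1 ?h2 ?h3 ?tupE ?(ceK ce) ?(deK de) //.
  by rewrite rwhiskA Aunit rwhisk_idc.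
- by rewrite -lrwhiskA pb_cpair2 rwhisk_idc h4 tupE.
Qed.

Hypotheses (α_dom : cdom α = m ∘ one_m cm) (α_cod : ccod α = m ∘ m_one dm).

(** Whiskering distributes over vertical composites of composable 2-cells only,
    whence the three composability checks. *)
Lemma pentagon_comp1 :
  cdom (α ▷ m_one_one dm) = ccod (α ▷ one_one_m cm).
Proof.
rewrite cdom_rwhisk ccod_rwhisk α_dom α_cod -!compA; congr (m ∘ _).
apply: prod2_ext; rewrite !tuprE !tupE /mul -compA; congr (m ∘ _).
- by apply: prod2_ext; rewrite !tuprE !tupE.
- by apply: prod2_ext; rewrite !tuprE !tupE.
Qed.

Lemma pentagon_comp2 :
  cdom (m ◁ α_one dα) = ccod (α ▷ one_m_one dm cm).
Proof.
rewrite ccod_rwhisk cdom_lwhisk α_cod -!compA; congr (m ∘ _).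
apply: prod2_ext; rewrite tuprE -cdom_lwhisk ?pb_cpair1 ?pb_cpair2.
- rewrite cdom_rwhisk α_dom /mul -!compA; congr (m ∘ _).
  apply: prod2_ext; rewrite !tuprE ?tupE //.
  by rewrite /mul -compA; congr (m ∘ _); apply: prod2_ext; rewrite !tuprE ?tupE.
- by rewrite cdom_idc tupE.
Qed.

Lemma pentagon_comp3 :
  cdom (α ▷ one_m_one dm cm) = ccod (m ◁ one_α cα).
Proof.
rewrite cdom_rwhisk ccod_lwhisk α_dom -!compA; congr (m ∘ _).
apply: prod2_ext; rewrite tuprE -ccod_lwhisk ?pb_cpair1 ?pb_cpair2.
- by rewrite ccod_idc tupE.
- rewrite ccod_rwhisk α_cod /mul -!compA; congr (m ∘ _).
  apply: prod2_ext; rewrite !tuprE ?tupE //.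
  by rewrite /mul -compA; congr (m ∘ _); apply: prod2_ext; rewrite !tuprE ?tupE.
Qed.

Lemma pentagon_rwhisk (W : K) (x : hom W P4) :
  ((α ▷ m_one_one dm) • (α ▷ one_one_m cm)) ▷ x
    = (α ▷ m_one_one dm ▷ x) • (α ▷ one_one_m cm ▷ x) /\
  ((m ◁ α_one dα) • (α ▷ one_m_one dm cm) • (m ◁ one_α cα)) ▷ x
    = (m ◁ α_one dα ▷ x) • (α ▷ one_m_one dm cm ▷ x) • (m ◁ one_α cα ▷ x).
Proof.
have h1 := pentagon_comp1; have h2 := pentagon_comp2; have h3 := pentagon_comp3.
by rewrite !rwhisk_vcomp ?cdom_vcomp.
Qed.

(** The pentagon at (x, 1, 1, 1), (1, y, 1, 1), (1, 1, z, 1) and (1, 1, 1, w). *)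
Definition pentagon_eqs : Prop :=
  [/\ (A1 ▷ R) • A1 = (R ◁ A1) • A1 • idc R,
      (A1 ▷ L) • A2 = (R ◁ A2) • (A2 ▷ R) • (L ◁ A1),
      A2 • (A3 ▷ R) = (R ◁ A3) • (A2 ▷ L) • (L ◁ A2) &
      A3 • (A3 ▷ L) = idc L • A3 • (L ◁ A3)].

Lemma pentagonP :
  (α ▷ m_one_one dm) • (α ▷ one_one_m cm)
    = (m ◁ α_one dα) • (α ▷ one_m_one dm cm) • (m ◁ one_α cα)
  <-> pentagon_eqs.
Proof.
have E1 : α ▷ m_one_one dm ▷ kt j1 = A1 ▷ L.
  rewrite -[A1 ▷ L]rwhiskA.
  by apply: assoc_m_one_one_tail;
    rewrite ?tuprE ?tupE ?comp1m ?compm1 // -compA d_left.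
have E2 : α ▷ m_one_one dm ▷ kt j2 = A2.
  by apply: assoc_m_one_one_tail; rewrite ?tupE // compA unit_left.
have E3 : α ▷ m_one_one dm ▷ kt j3 = A3.
  by apply: assoc_m_one_one_tail; rewrite ?tupE // compA unit_left.
have F1 : α ▷ one_one_m cm ▷ kt j1 = A2.
  by apply: assoc_one_one_m_tail; rewrite ?m23_in3_1 ?tupE ?compm1.
have F2 : α ▷ one_one_m cm ▷ kt j2 = A3 ▷ R.
  rewrite -[A3 ▷ R]rwhiskA.
  by apply: assoc_one_one_m_tail;
    rewrite ?m23_in3_2 ?tuprE ?tupE ?comp1m ?(ceK ce) // -compA c_right.
have F3 : α ▷ one_one_m cm ▷ kt j3 = A3 ▷ L.
  rewrite -[A3 ▷ L]rwhiskA.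
  by apply: assoc_one_one_m_tail;
    rewrite ?m23_in3_3 ?tuprE ?tupE ?comp1m ?(ceK ce) // -compA c_left.
have G1 : α ▷ one_m_one dm cm ▷ kt j1 = A2 ▷ R.
  rewrite -[A2 ▷ R]rwhiskA.
  by apply: assoc_one_m_one_tail;
    rewrite ?m12_in3_1 ?tuprE ?tupE ?comp1m ?compm1 // -compA ?c_right ?d_right.
have G2 : α ▷ one_m_one dm cm ▷ kt j2 = A2 ▷ L.
  rewrite -[A2 ▷ L]rwhiskA.
  by apply: assoc_one_m_one_tail;
    rewrite ?m12_in3_2 ?tuprE ?tupE ?comp1m ?(ceK ce) // -compA ?c_left ?d_left.
have G3 : α ▷ one_m_one dm cm ▷ kt j3 = A3.
  by apply: assoc_one_m_one_tail; rewrite ?m12_in3_3 ?tupE ?(ceK ce).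
have H1 : m ◁ α_one dα ▷ kt j1 = R ◁ A2.
  by apply: α_one_tail; rewrite ?tupE ?compm1 ?(deK de).
have H2 : m ◁ α_one dα ▷ kt j2 = R ◁ A3.
  by apply: α_one_tail; rewrite ?tupE ?compm1 ?(ceK ce).
have red x := pentagon_rwhisk x.
split=> [P|[e1 e2 e3 e4]].
- split.
  + move: (f_equal (fun κ => κ ▷ k1) P); have [-> ->] := red _ k1.
    by rewrite assoc_m_one_one_head assoc_one_one_m_head α_one_head
      assoc_one_m_one_head one_α_head.
  + move: (f_equal (fun κ => κ ▷ kt j1) P); have [-> ->] := red _ (kt j1).
    by rewrite E1 F1 H1 G1 one_α_tail.
  + move: (f_equal (fun κ => κ ▷ kt j2) P); have [-> ->] := red _ (kt j2).
    by rewrite E2 F2 H2 G2 one_α_tail.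
  + move: (f_equal (fun κ => κ ▷ kt j3) P); have [-> ->] := red _ (kt j3).
    by rewrite E3 F3 α_one_tail_3 G3 one_α_tail.
apply: (@cell4_ext _ PB _ _ d c e wm de ce).
- have [-> ->] := red _ k1.
  by rewrite assoc_m_one_one_head assoc_one_one_m_head α_one_head
      assoc_one_m_one_head one_α_head.
- by have [-> ->] := red _ (kt j1); rewrite E1 F1 H1 G1 one_α_tail.
- by have [-> ->] := red _ (kt j2); rewrite E2 F2 H2 G2 one_α_tail.
- by have [-> ->] := red _ (kt j3); rewrite E3 F3 α_one_tail_3 G3 one_α_tail.
Qed.

End Pentagon.

Section Triangle.
Context (lam rho : cell C1 C1).
Hypotheses (α_cod : ccod α = m ∘ m_one dm) (rho_dom : cdom rho = R)
  (clam : c ◁ lam = idc c) (drho : d ◁ rho = idc d)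
  (lam_e : lam ▷ e = idc e) (rho_e : rho ▷ e = idc e).

Lemma triangle_comp :
  cdom (m ◁ rho_one PB c drho) = ccod (α ▷ mid_unit PB de ce).
Proof.
rewrite ccod_rwhisk cdom_lwhisk α_cod -!compA; congr (m ∘ _).
apply: prod2_ext; rewrite tuprE -cdom_lwhisk ?pb_cpair1 ?pb_cpair2.
- rewrite cdom_rwhisk rho_dom /mul -[RHS]compA; symmetry.
  by apply: hom_right; rewrite tuprE tupE -?compA.
- by rewrite cdom_idc tupE.
Qed.

(** The triangle at the pairs (x, 1) and (1, y). *)
Lemma triangleP :
  (m ◁ rho_one PB c drho) • (α ▷ mid_unit PB de ce) = m ◁ one_lam PB d clam
  <-> (R ◁ rho) • A1 = idc R /\ idc L • A3 = L ◁ lam.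
Proof.
have E1 : m ◁ rho_one PB c drho ▷ i1 = R ◁ rho.
  rewrite lrwhiskA; apply: cell_right.
  - by rewrite -lrwhiskA pb_cpair1 -rwhiskA tupE rwhisk1.
  - by rewrite -lrwhiskA pb_cpair2 rwhisk_idc tupE lwhiskA drho lwhisk_idc.
have E2 : m ◁ rho_one PB c drho ▷ i2 = idc L.
  rewrite lrwhiskA (@cell_left _ _ (idc (idm C1))) ?lwhisk_idc ?compm1 //.
  - by rewrite -lrwhiskA pb_cpair1 -rwhiskA tupE rwhiskA rho_e rwhisk_idc.
  - by rewrite -lrwhiskA pb_cpair2 rwhisk_idc tupE.
have F1 : m ◁ one_lam PB d clam ▷ i1 = idc R.
  rewrite lrwhiskA (@cell_right _ _ (idc (idm C1))) ?lwhisk_idc ?compm1 //.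
  - by rewrite -lrwhiskA pb_cpair1 rwhisk_idc tupE.
  - by rewrite -lrwhiskA pb_cpair2 -rwhiskA tupE rwhiskA lam_e rwhisk_idc.
have F2 : m ◁ one_lam PB d clam ▷ i2 = L ◁ lam.
  rewrite lrwhiskA; apply: cell_left.
  - by rewrite -lrwhiskA pb_cpair1 rwhisk_idc tupE lwhiskA clam lwhisk_idc.
  - by rewrite -lrwhiskA pb_cpair2 -rwhiskA tupE rwhisk1.
have red W (x : hom W P2) := @rwhisk_vcomp _ _ _ _ _ _ x triangle_comp.
split=> [T|[t1 t2]].
- split.
  + move: (f_equal (fun κ => κ ▷ i1) T); rewrite red E1 F1 -rwhiskA.
    by rewrite hom_mid_unit_1.
  + move: (f_equal (fun κ => κ ▷ i2) T); rewrite red E2 F2 -rwhiskA.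
    by rewrite hom_mid_unit_2.
apply: (@cell2_ext _ PB _ _ d c e wm de ce); rewrite red -rwhiskA.
- by rewrite E1 F1 hom_mid_unit_1.
- by rewrite E2 F2 hom_mid_unit_2.
Qed.

End Triangle.
End Restriction.

(** * Homogeneous pseudocategories and their restrictions *)

Section Coherence.
Context (K : two_category) (wm : cells_weakly_maltsev K) (PB : pullbacks K)
  (C0 C1 : K) (d c : hom C1 C0) (e : hom C0 C1).
Hypotheses (de : d ∘ e = idm C0) (ce : c ∘ e = idm C0).
Context (m : hom (prod2 PB d c) C1) (α : cell (prod3 PB d c) C1)
  (lam rho lam' rho' : cell C1 C1).
Hypotheses (lamK : inverse_cells lam lam') (rhoK : inverse_cells rho rho').
Hypotheses (lam_cod : ccod lam = idm C1) (rho_cod : ccod rho = idm C1).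
Hypotheses (lam_e : lam ▷ e = idc e) (rho_e : rho ▷ e = idc e).
Hypotheses (dlam : d ◁ lam = idc d) (drho : d ◁ rho = idc d)
  (clam : c ◁ lam = idc c) (crho : c ◁ rho = idc c).
Local Notation i1 := (e1 PB d ce).
Local Notation i2 := (e2 PB c de).
Local Notation R := (cdom rho).
Local Notation L := (cdom lam).
Local Notation A1 := (α ▷ in3_1 PB de ce).
Local Notation A2 := (α ▷ in3_2 PB de ce).
Local Notation A3 := (α ▷ in3_3 PB de ce).

Definition unit_restrictions : Prop := m ∘ i1 = R /\ m ∘ i2 = L.

Definition associator_restrictions : Prop :=
  [/\ A1 = rho' ▷ R, A2 = (R ◁ lam') • (lam ▷ R) & A3 = lam ▷ L].

Lemma inverse_unit (τ τ' : cell C1 C1) : inverse_cells τ τ' ->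
  τ ▷ e = idc e -> τ' ▷ e = idc e.
Proof.
move=> /(inverse_rwhisk e) i h; rewrite h in i.
exact: (inverse_uniq i (inverse_idc e)).
Qed.

Lemma dom_unit (τ : cell C1 C1) : τ ▷ e = idc e -> cdom τ ∘ e = e.
Proof. by rewrite -cdom_rwhisk => ->; rewrite cdom_idc. Qed.

Lemma L_lam : L ◁ lam = lam ▷ L.
Proof. by rewrite (rwhisk_dom lamK). Qed.

Lemma R_rho' : R ◁ rho' = rho' ▷ R.
Proof.
have := inverse_lwhisk R rhoK; rewrite -(rwhisk_dom rhoK rho_cod) => i.
exact: (inverse_uniq i (inverse_rwhisk R rhoK)).
Qed.

(** Naturality of λ: L => 1. *)
Lemma nat_lam (τ : cell C1 C1) : τ • (lam ▷ cdom τ) = (lam ▷ ccod τ) • (L ◁ τ).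
Proof. by rewrite interchange lam_cod lwhisk1. Qed.

(** The triangle at (x, 1) and (1, y) gives (R ρ) • A1 = 1 and A3 = L λ.  For A2,
    the pentagon at (1, 1, z, 1) reads A2 • (λ L R) = (R λ L) • (A2 L) • (L A2), and
    naturality of λ at A2 turns the left-hand side into (λ R L) • (L A2).  Cancelling
    the invertible L A2 leaves (R λ) • A2 = λ R whiskered with L, which is isomorphic
    to the identity.  This is the classical proof that the triangle at a unit in the
    first place follows from the one at a unit in the middle. *)
Theorem pseudocategory_restrictions :
  homogeneous_pseudocategory PB d c e m α lam rho ->
  unit_restrictions /\ associator_restrictions.
Proof.
case=> [[de_ ce_ dm cm [α' αK] α_dom α_cod _ lam_dom _ _ rho_dom _
  _ drho_ clam_ _ dα cα _ pent tri] _].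
(* The record carries its own proofs of de = 1 = ce, inside the pairings. *)
have E1 : e1 PB d ce_ = i1 by apply: prod2_ext; rewrite !tupE.
have E2 : e2 PB c de_ = i2 by apply: prod2_ext; rewrite !tupE.
have E3 : mid_unit PB de_ ce_ = mid_unit PB de ce by apply: prod3_ext; rewrite !tupE.
rewrite E1 in rho_dom; rewrite E2 in lam_dom; rewrite E3 in tri.
split; first by split.
have Re : m ∘ i1 ∘ e = e by rewrite -rho_dom dom_unit.
have A1_cod : ccod A1 = R ∘ R.
  by rewrite ccod_rwhisk α_cod hom_m_one_1 -?rho_dom.
have A2_dom : cdom A2 = L ∘ R.
  by rewrite cdom_rwhisk α_dom hom_one_m_2 -?rho_dom -?lam_dom.
have A2_cod : ccod A2 = R ∘ L.
  by rewrite ccod_rwhisk α_cod hom_m_one_2 -?rho_dom -?lam_dom.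
have A3_cod : ccod A3 = L.
  by rewrite ccod_rwhisk α_cod (hom_m_one_3 de dm Re) -?lam_dom.
move/(triangleP wm de α_cod rho_dom clam_ drho_ lam_e rho_e): tri.
rewrite -rho_dom -lam_dom => -[t1 t2].
have A1E : A1 = rho' ▷ R.
  have := vcomp_solve (inverse_lwhisk R rhoK) _ t1.
  rewrite cdom_lwhisk A1_cod => -> //.
  rewrite vcomp_idr ?R_rho' // cdom_rwhisk.
  by have [-> _ _ _] := rhoK; rewrite rho_cod comp1m.
have A3E : A3 = lam ▷ L by rewrite -L_lam -t2 vcomp_idl.
have A1e : A1 ▷ e = idc e.
  by rewrite A1E -rwhiskA dom_unit // (inverse_unit rhoK).
split=> //.
move/(pentagonP wm Re dα cα A1e α_dom α_cod): pent => -[_ _].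
rewrite -rho_dom -lam_dom A3E => e3 _.
apply: (vcomp_solve (inverse_lwhisk R lamK)).
  by rewrite cdom_lwhisk A2_cod.
have comp1 : cdom (R ◁ lam) = ccod A2 by rewrite cdom_lwhisk A2_cod.
apply: (rwhisk_iso_faithful lamK lam_cod).
- by rewrite cdom_vcomp // A2_dom cdom_rwhisk.
- by rewrite ccod_vcomp // ccod_rwhisk ccod_lwhisk lam_cod comp1m compm1.
(* The equation sought, whiskered with L, is compared after composing with L A2. *)
have A2K := inverse_lwhisk L (inverse_rwhisk (in3_2 PB de ce) αK).
have comp2 : cdom (R ◁ lam ▷ L) = ccod (A2 ▷ L).
  by rewrite ccod_rwhisk cdom_rwhisk comp1.
apply: (vcomp_cancelr A2K).
- by rewrite ccod_lwhisk rwhisk_vcomp // cdom_vcomp // (cdom_rwhisk A2) A2_dom A2_cod compA.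
- by rewrite ccod_lwhisk !cdom_rwhisk A2_cod compA.
have := nat_lam A2; rewrite A2_dom A2_cod !rwhiskA => <-.
by rewrite rwhisk_vcomp // lrwhiskA e3.
Qed.

(** Every equation is checked on tuples with one non-identity entry.  There, the
    pentagon consists of instances of interchange, of R ρ = ρ R and L λ = λ L, and of
    cancellation of λ against its inverse. *)
Theorem pseudocategory_of_restrictions : invertible α ->
  unit_restrictions -> associator_restrictions ->
  homogeneous_pseudocategory PB d c e m α lam rho.
Proof.
move=> αK [rho_dom lam_dom] [A1E A2E A3E].
have [lam'_dom lam'_cod lam'l lam'r] := lamK.
have [rho'_dom rho'_cod rho'l rho'r] := rhoK.
rewrite lam_cod in lam'_dom lam'r; rewrite rho_cod in rho'_dom rho'r.
have dL : d ∘ L = d by rewrite -cdom_lwhisk dlam cdom_idc.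
have dR : d ∘ R = d by rewrite -cdom_lwhisk drho cdom_idc.
have cL : c ∘ L = c by rewrite -cdom_lwhisk clam cdom_idc.
have cR : c ∘ R = c by rewrite -cdom_lwhisk crho cdom_idc.
have Le : L ∘ e = e by apply: dom_unit.
have Re : R ∘ e = e by apply: dom_unit.
have Re' : m ∘ i1 ∘ e = e by rewrite rho_dom.
have dm : d ∘ m = d ∘ pi2_2.
  apply: (hom2_ext wm (de := de) (ce := ce)); rewrite -!compA !tupE.
  - by rewrite rho_dom dR compA de comp1m.
  - by rewrite lam_dom dL compm1.
have cm : c ∘ m = c ∘ pi2_1.
  apply: (hom2_ext wm (de := de) (ce := ce)); rewrite -!compA !tupE.
  - by rewrite rho_dom cR compm1.
  - by rewrite lam_dom cL compA ce comp1m.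
have drho' : d ◁ rho' = idc d.
  have := inverse_lwhisk d rhoK; rewrite drho => i.
  exact: (inverse_uniq i (inverse_idc d)).
have crho' : c ◁ rho' = idc c.
  have := inverse_lwhisk c rhoK; rewrite crho => i.
  exact: (inverse_uniq i (inverse_idc c)).
have dlam' : d ◁ lam' = idc d.
  have := inverse_lwhisk d lamK; rewrite dlam => i.
  exact: (inverse_uniq i (inverse_idc d)).
have clam' : c ◁ lam' = idc c.
  have := inverse_lwhisk c lamK; rewrite clam => i.
  exact: (inverse_uniq i (inverse_idc c)).
have comp2 : cdom (R ◁ lam') = ccod (lam ▷ R).
  by rewrite cdom_lwhisk ccod_rwhisk lam'_dom lam_cod comp1m compm1.
have α_dom : cdom α = m ∘ one_m cm.
  apply: (hom3_ext wm (de := de) (ce := ce)); rewrite -cdom_rwhisk.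
  - by rewrite hom_one_m_1 // rho_dom A1E cdom_rwhisk rho'_dom comp1m.
  - by rewrite hom_one_m_2 rho_dom lam_dom A2E cdom_vcomp // cdom_rwhisk.
  - by rewrite hom_one_m_3 lam_dom A3E cdom_rwhisk.
have α_cod : ccod α = m ∘ m_one dm.
  apply: (hom3_ext wm (de := de) (ce := ce)); rewrite -ccod_rwhisk.
  - by rewrite hom_m_one_1 rho_dom A1E ccod_rwhisk rho'_cod.
  - by rewrite hom_m_one_2 rho_dom lam_dom A2E ccod_vcomp // ccod_lwhisk lam'_cod.
  - by rewrite hom_m_one_3 // lam_dom A3E ccod_rwhisk lam_cod comp1m.
have dα : d ◁ α = idc (d ∘ pi3_3).
  apply: (cell3_ext wm (de := de) (ce := ce)); rewrite lrwhiskA rwhisk_idc -compA tupE.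
  - by rewrite A1E -lrwhiskA drho' rwhisk_idc dR (deK de).
  - rewrite A2E lwhisk_vcomp // -lwhiskA -lrwhiskA dR dlam' dlam rwhisk_idc dR.
    by rewrite (deK de) vcomp_idl ?ccod_idc.
  - by rewrite A3E -lrwhiskA dlam rwhisk_idc dL compm1.
have cα : c ◁ α = idc (c ∘ pi3_1).
  apply: (cell3_ext wm (de := de) (ce := ce)); rewrite lrwhiskA rwhisk_idc -compA tupE.
  - by rewrite A1E -lrwhiskA crho' rwhisk_idc cR compm1.
  - rewrite A2E lwhisk_vcomp // -lwhiskA -lrwhiskA cR clam' clam rwhisk_idc cR.
    by rewrite (ceK ce) vcomp_idl ?ccod_idc.
  - by rewrite A3E -lrwhiskA clam rwhisk_idc cL (ceK ce).
have A1e : A1 ▷ e = idc e.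
  by rewrite A1E -rwhiskA dom_unit // (inverse_unit rhoK).
have pent := (pentagonP wm Re' dα cα A1e α_dom α_cod).2.
have tri := (triangleP wm de α_cod (esym rho_dom) clam drho lam_e rho_e).2.
split=> //; apply: (@Pseudocategory _ PB _ _ d c e m α lam rho de ce dm cm αK
  α_dom α_cod (ex_intro _ _ lamK) (esym lam_dom) lam_cod (ex_intro _ _ rhoK)
  (esym rho_dom) rho_cod dlam drho clam crho dα cα).
- by rewrite lam_e rho_e.
- apply: pent; split; rewrite ?rho_dom ?lam_dom.
  (* (x, 1, 1, 1): both sides are (ρ' R R) • (ρ' R), where ρ' inverts ρ. *)
  + rewrite A1E -lrwhiskA R_rho' vcomp_idr //.
    rewrite cdom_vcomp ?cdom_rwhisk ?ccod_rwhisk ?rho'_dom ?rho'_cod ?comp1m //.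
  (* (1, y, 1, 1): both sides are (R R λ') • (λ R R) • (L ρ' R). *)
  + rewrite A1E A2E.
    have cA : cdom (rho' ▷ R ▷ L) = ccod (R ◁ lam').
      by rewrite !cdom_rwhisk ccod_lwhisk rho'_dom lam'_cod comp1m.
    have N1 : (rho' ▷ R ▷ L) • (R ◁ lam') = (R ∘ R ◁ lam') • (rho' ▷ R).
      have := interchange (rho' ▷ R) lam'.
      by rewrite lam'_cod lam'_dom rwhisk1 cdom_rwhisk ccod_rwhisk rho'_dom rho'_cod comp1m.
    have N2 := nat_lam (rho' ▷ R).
    rewrite cdom_rwhisk ccod_rwhisk rho'_dom rho'_cod comp1m in N2.
    have c1 : cdom (R ∘ R ◁ lam') = ccod (rho' ▷ R).
      by rewrite cdom_lwhisk ccod_rwhisk lam'_dom rho'_cod compm1.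
    have c2 : cdom (rho' ▷ R) = ccod (lam ▷ R).
      by rewrite cdom_rwhisk ccod_rwhisk rho'_dom lam_cod.
    rewrite vcompA // N1 -vcompA // N2.
    rewrite lwhisk_vcomp // rwhisk_vcomp // -lwhiskA -!lrwhiskA -rwhiskA.
    have c3 : cdom (R ∘ R ◁ lam') = ccod (R ◁ lam ▷ R).
      by rewrite cdom_lwhisk ccod_rwhisk ccod_lwhisk lam'_dom lam_cod !compm1.
    have c4 : cdom (R ◁ lam ▷ R) = ccod (R ◁ lam' ▷ R).
      by rewrite !cdom_rwhisk !ccod_rwhisk cdom_lwhisk ccod_lwhisk lam'_cod.
    have c5 : cdom (R ◁ lam' ▷ R) = ccod (lam ▷ (R ∘ R)).
      by rewrite cdom_rwhisk ccod_rwhisk cdom_lwhisk lam'_dom lam_cod compm1 comp1m.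
    have c6 : cdom (lam ▷ (R ∘ R)) = ccod (L ◁ rho' ▷ R).
      by rewrite cdom_rwhisk ccod_rwhisk ccod_lwhisk rho'_cod compA.
    have I : (R ◁ lam ▷ R) • (R ◁ lam' ▷ R) = idc (R ∘ R).
      by rewrite -rwhisk_vcomp ?cdom_lwhisk ?ccod_lwhisk ?lam'_cod // -lwhisk_vcomp
        ?lam'_cod // lam'r lwhisk_idc rwhisk_idc compm1.
    rewrite -(vcompA c3) ?ccod_vcomp // (vcompA c4) // I vcomp_idl.
      by rewrite vcompA // c3 ccod_rwhisk ccod_lwhisk lam_cod compm1 ccod_rwhisk lam_cod comp1m.
    by rewrite ccod_rwhisk lam_cod comp1m.
  (* (1, 1, z, 1): after cancelling R λ L against its inverse inside A2 L, this is
     naturality of λ at A2. *)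
  + have A2_dom : cdom A2 = L ∘ R by rewrite A2E cdom_vcomp // cdom_rwhisk.
    have A2_cod : ccod A2 = R ∘ L by rewrite A2E ccod_vcomp // ccod_lwhisk lam'_cod.
    have N := nat_lam A2; rewrite A2_dom A2_cod in N.
    rewrite A3E -rwhiskA N; congr (_ • _).
    rewrite A2E rwhisk_vcomp // vcompA.
    * rewrite -lrwhiskA -rwhisk_vcomp ?cdom_lwhisk ?ccod_lwhisk ?lam'_cod //.
      rewrite -lwhisk_vcomp ?lam'_cod // lam'r lwhisk_idc rwhisk_idc compm1 -rwhiskA.
      by rewrite vcomp_idl // ccod_rwhisk lam_cod comp1m.
    * by rewrite cdom_lwhisk cdom_rwhisk ccod_rwhisk ccod_lwhisk lam'_cod compA.
    * by rewrite !cdom_rwhisk !ccod_rwhisk comp2 ccod_rwhisk.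
  (* (1, 1, 1, w): both sides are (λ L) • (λ L L). *)
  + by rewrite A3E -lrwhiskA L_lam vcomp_idl // ccod_rwhisk lam_cod comp1m.
- apply: tri; rewrite rho_dom lam_dom A1E A3E -R_rho' -L_lam; split.
  + by rewrite -lwhisk_vcomp ?rho'_cod // rho'r lwhisk_idc compm1.
  + by rewrite vcomp_idl // ccod_lwhisk lam_cod compm1.
Qed.

End Coherence.

(** * The Mal'tsev decomposition in internal groupoids *)

Section Groupoids.
Context (A B : category) (limA : has_finite_limits A)
  (limB : has_finite_limits B) (V : functor A B) (faithV : faithful V)
  (presV : preserves_finite_limits V) (p : maltsev_operation limB V).
Local Notation G := (GA limA faithV presV p).

Lemma Vhom_comp (X Y Z : G) (g : hom Y Z) (f : hom X Y) :
  Vhom (g ∘ f) = Vhom g ∘ Vhom f.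
Proof. exact: fmapM. Qed.

Lemma Vcell_rwhisk (X Y Z : G) (τ : cell Y Z) (u : hom X Y) :
  Vcell (τ ▷ u) = Vcell τ ∘ Vhom u.
Proof. exact: fmapM. Qed.

Lemma Vhom_inj (X Y : G) (f g : hom X Y) : Vhom f = Vhom g -> f = g.
Proof. by move=> h; apply: ghom_eq; apply: faithV. Qed.

Lemma Vcell_inj (X Y : G) (σ τ : cell X Y) : Vcell σ = Vcell τ -> σ = τ.
Proof. by move=> h; apply: gcell_eq; apply: faithV. Qed.

Lemma Vcell_idc (X Y : G) (f : hom X Y) : Vcell (idc f) = Vhom f.
Proof. by []. Qed.

(** An arbitrary pullback of internal groupoids is isomorphic to the one computed in
    A, whose image under V is a pullback in B. *)
Lemma V_pullback_monic (X Y Z : G) (f : hom X Z) (g : hom Y Z)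
  (P : pullback f g) (W : B) (w w' : hom W (V (carrier (pb_ob P)))) :
  Vhom (pb1 P) ∘ w = Vhom (pb1 P) ∘ w' ->
  Vhom (pb2 P) ∘ w = Vhom (pb2 P) ∘ w' -> w = w'.
Proof.
pose Q : @pullback G X Y Z f g := pull1 limA faithV presV f g.
pose φ : hom P Q := pb_pair Q (pb_comm P).
pose ψ : hom Q P := pb_pair P (pb_comm Q).
have φ1 : pb1 Q ∘ φ = pb1 P by apply: pb_pair1.
have φ2 : pb2 Q ∘ φ = pb2 P by apply: pb_pair2.
have ψφ : ψ ∘ φ = idm P.
  by apply: (pb_uniq P); rewrite compA ?pb_pair1 ?pb_pair2 compm1.
rewrite -φ1 -φ2 !Vhom_comp -!compA => h1 h2.
have h : Vhom φ ∘ w = Vhom φ ∘ w' by apply: (preserved_uniq presV).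
have i : Vhom ψ ∘ Vhom φ = idm (V (carrier (pb_ob P))).
  by rewrite -Vhom_comp ψφ; apply: fmap1.
by rewrite -(comp1m w) -(comp1m w') -i -!compA h.
Qed.

Lemma Vhom_pt (X Y Z : G) (v : hom Y Z) (x y z : hom X Y) :
  Vhom v ∘ pt p (Vhom x) (Vhom y) (Vhom z)
  = pt p (Vhom (v ∘ x)) (Vhom (v ∘ y)) (Vhom (v ∘ z)).
Proof. by rewrite !Vhom_comp; apply: pt_map. Qed.

Section Split.
Context (X Y Z : G) (f : hom X Y) (g : hom Z Y) (r : hom Y X) (s : hom Y Z)
  (P : pullback f g) (i : hom X P) (j : hom Z P).
Hypotheses (fr : f ∘ r = idm Y) (gs : g ∘ s = idm Y)
  (i1 : pb1 P ∘ i = idm X) (i2 : pb2 P ∘ i = s ∘ f)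
  (j1 : pb1 P ∘ j = r ∘ g) (j2 : pb2 P ∘ j = idm Z).

(** On elements, (x, z) = p((x, s f x), (r f x, s f x), (r g z, z)), where the middle
    pair is i(r f x) because f r = 1; this holds in each coordinate by the
    Mal'tsev identities. *)
Lemma V_split_id :
  pt p (Vhom (i ∘ pb1 P)) (Vhom (i ∘ r ∘ (f ∘ pb1 P))) (Vhom (j ∘ pb2 P))
  = idm (V (carrier (pb_ob P))).
Proof.
apply: V_pullback_monic; rewrite compm1 Vhom_pt !compA.
- by rewrite i1 j1 !comp1m -[r ∘ g ∘ _]compA -pb_comm compA pt_xyy.
- by rewrite i2 j2 !comp1m -[s ∘ f ∘ r]compA fr compm1 pt_yyx.
Qed.

(** p is natural, so every κ out of the pullback commutes with the decomposition of
    the elements of the pullback. *)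
Lemma Vcell_split (W : G) (κ : cell P W) :
  Vcell κ = pt p (Vcell (κ ▷ i ▷ pb1 P)) (Vcell (κ ▷ i ▷ r ▷ (f ∘ pb1 P)))
                 (Vcell (κ ▷ j ▷ pb2 P)).
Proof.
rewrite -{1}[Vcell κ]compm1 -V_split_id pt_map -!Vcell_rwhisk.
by rewrite !rwhiskA.
Qed.

End Split.

(** The decomposition expresses κ through its composites with the two injections. *)
Lemma groupoid_cells_weakly_maltsev : cells_weakly_maltsev G.
Proof.
move=> X Y Z f g r s fr gs P W κ κ' hi hj; apply: Vcell_inj.
rewrite (Vcell_split fr (pb_pair1 P (split_left f gs))
  (pb_pair2 P (split_left f gs)) (pb_pair1 P (split_right g fr))
  (pb_pair2 P (split_right g fr)) κ) hi hj.
by rewrite -(Vcell_split fr (pb_pair1 P (split_left f gs))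
  (pb_pair2 P (split_left f gs)) (pb_pair1 P (split_right g fr))
  (pb_pair2 P (split_right g fr)) κ').
Qed.

Section Inverse.
Context (X Y : G) (τ : cell X Y).

Lemma cod_opp : gcod faithV (gopp faithV τ) = gdom faithV τ.
Proof.
apply: ghom_eq; apply: faithV; rewrite /= V_cod.
(* Expanding cod τ and cancelling τ leaves an expression in the form required by
   [pt_cancel_right]. *)
have oppE : fmap V (carr (gopp faithV τ)) =
    pt p (fmap V (dom_arr τ)) (fmap V (carr τ ∘ gs X)) (fmap V (gt Y ∘ carr τ ∘ gs X)).
  rewrite V_opp /= V_cod -(pt_assoc limA presV) -?fmapM ?pt_xyy //.
  - by rewrite s_dom.
  - by rewrite -!compA gttr.
have topp : gt Y ∘ carr (gopp faithV τ) = gs Y ∘ carr τ ∘ gt X.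
  by apply: faithV; rewrite fmapM V_opp pt_map -!fmapM /= t_cod // pt_xyy t_dom.
rewrite topp -[gs Y ∘ _ ∘ gt X ∘ gs X]compA gts.
rewrite [fmap V (carr (gopp faithV τ) ∘ _)]fmapM oppE pt_comp -!fmapM.
rewrite -dom_arr_s // s_dom // -!compA gss (pt_cancel_right limA presV) -?fmapM //.
- by rewrite -carr_s -compA pt_xyy.
- by rewrite s_dom // compA carr_s.
- by rewrite gssr compA carr_s.
- by rewrite gttr.
Qed.

Lemma dom_opp : gdom faithV (gopp faithV τ) = gcod faithV τ.
Proof.
apply: ghom_eq; apply: faithV; rewrite /= V_dom.
have oppE : fmap V (carr (gopp faithV τ)) =
    pt p (fmap V (gs Y ∘ carr τ ∘ gt X)) (fmap V (carr τ ∘ gt X)) (fmap V (cod_arr τ)).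
  rewrite V_opp /= V_dom (pt_assoc limA presV) -?fmapM ?pt_yyx //.
  - by rewrite -!compA gssr.
  - by rewrite compA carr_t.
  - by rewrite t_cod.
have sopp : gs Y ∘ carr (gopp faithV τ) = gt Y ∘ carr τ ∘ gs X.
  by apply: faithV; rewrite fmapM V_opp pt_map -!fmapM /= s_dom // pt_yyx s_cod.
rewrite sopp -[gt Y ∘ _ ∘ gs X ∘ gt X]compA gst.
rewrite [fmap V (carr (gopp faithV τ) ∘ _)]fmapM oppE pt_comp -!fmapM.
rewrite -cod_arr_t // t_cod // -!compA gtt (pt_cancel_left limA presV) -?fmapM //.
- by rewrite compA carr_t pt_yyx.
- by rewrite gssr.
- by rewrite gttr compA carr_t.
- by rewrite t_cod // compA carr_t.
Qed.

Lemma vinv_inverse : inverse_cells τ (vinv τ).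
Proof.
split; [exact: dom_opp|exact: cod_opp| |]; apply: Vcell_inj; rewrite /Vcell /=.
- change (fmap V (carr (gplus faithV (gopp faithV τ) τ)) = fmap V (dom_arr τ)).
  by rewrite V_plus ?dom_opp // V_opp (pt_assoc limA presV) -?fmapM ?pt_yyx ?pt_xyy
    /= ?s_dom ?t_cod.
- change (fmap V (carr (gplus faithV τ (gopp faithV τ))) = fmap V (cod_arr τ)).
  by rewrite V_plus ?cod_opp // V_opp -(pt_assoc limA presV) -?fmapM ?pt_yyx ?pt_xyy
    /= ?s_dom ?t_cod ?pt_yyx.
Qed.

Lemma groupoid_cell_invertible : invertible τ.
Proof. by exists (vinv τ); apply: vinv_inverse. Qed.

End Inverse.

(** * The formulas for the multiplication and the associator *)

Section Formulas.
Context (PB : pullbacks G) (C0 C1 : G) (d c : hom C1 C0) (e : hom C0 C1).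
Hypotheses (de : d ∘ e = idm C0) (ce : c ∘ e = idm C0).
Context (m : hom (prod2 PB d c) C1) (α : cell (prod3 PB d c) C1)
  (lam rho : cell C1 C1).
Hypotheses (lam_e : lam ▷ e = idc e) (rho_e : rho ▷ e = idc e).
Hypotheses (lam_cod : ccod lam = idm C1) (rho_cod : ccod rho = idm C1).
Local Notation i1 := (e1 PB d ce).
Local Notation i2 := (e2 PB c de).

Lemma Vcell_prod2 (W : G) (κ : cell (prod2 PB d c) W) :
  Vcell κ = pt p (Vcell (κ ▷ i1 ▷ pi2_1)) (Vcell (κ ▷ i1 ▷ e ▷ (d ∘ pi2_1)))
                 (Vcell (κ ▷ i2 ▷ pi2_2)).
Proof. by apply: (Vcell_split de (s := e)); rewrite [LHS]tupE. Qed.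

Lemma Vcell_prod3 (W : G) (κ : cell (prod3 PB d c) W) :
  Vcell κ = pt p (Vcell (κ ▷ in3_1 PB de ce ▷ pi3_1))
    (Vcell (κ ▷ in3_1 PB de ce ▷ e ▷ (d ∘ pi3_1)))
    (pt p (Vcell (κ ▷ in3_2 PB de ce ▷ pi3_2))
      (Vcell (κ ▷ in3_2 PB de ce ▷ e ▷ (d ∘ pi3_2)))
      (Vcell (κ ▷ in3_3 PB de ce ▷ pi3_3))).
Proof.
rewrite (Vcell_split (f := d) (r := e) (s := i1 ∘ e) (P := prod3 PB d c) (i := in3_1 PB de ce)
  (j := in3_tail PB c de) de _ (in3_1_tail PB de ce)); rewrite ?pb_pair1 ?pb_pair2 //.
rewrite (Vcell_rwhisk (κ ▷ _) (pb2 _)) (Vcell_prod2 (κ ▷ _)) pt_comp -!Vcell_rwhisk.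
by rewrite -in3_tail_1 -in3_tail_2 -!rwhiskA -!compA.
Qed.

(** A formula of this shape evaluates to a1, a2 and a3 on (x, 1, 1), (1, y, 1) and
    (1, 1, z), because each ai is an identity on identity arrows; conversely it is
    the Mal'tsev decomposition of α. *)
Lemma Vcell_prod3P (a1 a2 a3 : cell C1 C1) :
  a1 ▷ e = idc e -> a2 ▷ e = idc e -> a3 ▷ e = idc e ->
  Vcell α = pt p (Vcell (a1 ▷ pi3_1)) (Vcell (idc e ▷ d ▷ pi3_1))
              (pt p (Vcell (a2 ▷ pi3_2)) (Vcell (idc e ▷ d ▷ pi3_2))
                    (Vcell (a3 ▷ pi3_3))) <->
  [/\ α ▷ in3_1 PB de ce = a1, α ▷ in3_2 PB de ce = a2
    & α ▷ in3_3 PB de ce = a3].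
Proof.
move=> a1e a2e a3e; split=> [h|[h1 h2 h3]].
  split; apply: Vcell_inj;
    rewrite Vcell_rwhisk h !pt_comp -!Vcell_rwhisk -!rwhiskA !tupE ?compm1.
  - by rewrite (deK de) !(rwhiskA _ e) a2e a3e rwhisk1 !pt_xyy.
  - by rewrite (deK de) !(rwhiskA _ e) a1e a3e rwhisk1 pt_yyx pt_xyy.
  - by rewrite (deK de) !(rwhiskA _ e) a1e a2e rwhisk1 !pt_yyx.
by rewrite Vcell_prod3 h1 h2 h3 a1e a2e !rwhiskA.
Qed.

Lemma mult_formulaP : mult_formula PB d c e lam rho m <->
  unit_restrictions de ce m lam rho.
Proof.
have Le := dom_unit lam_e; have Re := dom_unit rho_e.
split=> [h|[h1 h2]].
- split; apply: Vhom_inj; rewrite Vhom_comp h pt_comp -!Vhom_comp -!compA !tupE.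
  + by rewrite !compm1 [_ ∘ (e ∘ d)]compA Le pt_xyy.
  + by rewrite !compm1 [d ∘ _]compA de comp1m [_ ∘ (e ∘ c)]compA Re pt_yyx.
- rewrite /mult_formula -Vcell_idc Vcell_prod2 !rwhisk_idc h1 h2 Re.
  by rewrite !Vcell_idc compA.
Qed.

Lemma assoc_formulaP : assoc_formula PB d c e lam rho α <->
  associator_restrictions de ce α lam rho (vinv lam) (vinv rho).
Proof.
have Le := dom_unit lam_e; have Re := dom_unit rho_e.
have α1E : α1 rho = vinv rho ▷ cdom rho by [].
have α2E : α2 lam rho = (cdom rho ◁ vinv lam) • (lam ▷ cdom rho).
  rewrite /α2; congr (_ • _).
  apply: (inverse_uniq (vinv_inverse _)).
  exact: (inverse_lwhisk (cdom rho) (vinv_inverse lam)).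
have α3E : α3 lam = lam ▷ cdom lam by [].
have lam'e := inverse_unit (vinv_inverse lam) lam_e.
have rho'e := inverse_unit (vinv_inverse rho) rho_e.
have α1e : α1 rho ▷ e = idc e by rewrite α1E -rwhiskA Re.
have α2e : α2 lam rho ▷ e = idc e.
  rewrite α2E rwhisk_vcomp.
    rewrite lrwhiskA -rwhiskA Re lam'e lam_e lwhisk_idc Re.
    by rewrite vcomp_idl ?ccod_idc.
  rewrite cdom_lwhisk ccod_rwhisk.
  by have [-> _ _ _] := vinv_inverse lam; rewrite lam_cod comp1m compm1.
have α3e : α3 lam ▷ e = idc e by rewrite α3E -rwhiskA Le.
rewrite /assoc_formula (Vcell_prod3P α1e α2e α3e).
by rewrite /associator_restrictions α1E α2E α3E.
Qed.

End Formulas.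
End Groupoids.

Theorem proposition6p3 (A B : category)
  (limA : has_finite_limits A) (limB : has_finite_limits B)
  (V : functor A B) (faithV : faithful V) (presV : preserves_finite_limits V)
  (wmA : weakly_maltsev A) (p : maltsev_operation limB V)
  (PB : pullbacks (GA limA faithV presV p))
  (C0 C1 : GA limA faithV presV p)
  (d c : hom C1 C0) (e : hom C0 C1)
  (m : hom (prod2 PB d c) C1) (α : cell (prod3 PB d c) C1)
  (lam rho : cell C1 C1) :
  (homogeneous_pseudocategory PB d c e m α lam rho ->
     (d ∘ e = idm C0 /\ c ∘ e = idm C0) /\
     (d ◁ lam = idc d /\ d ◁ rho = idc d) /\
     (c ◁ lam = idc c /\ c ◁ rho = idc c) /\
     (lam ▷ e = idc e /\ rho ▷ e = idc e) /\
     (ccod lam = idm C1 /\ ccod rho = idm C1) /\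
     unique (mult_formula PB d c e lam rho) m /\
     unique (assoc_formula PB d c e lam rho) α) /\
  (d ∘ e = idm C0 -> c ∘ e = idm C0 ->
   d ◁ lam = idc d -> d ◁ rho = idc d ->
   c ◁ lam = idc c -> c ◁ rho = idc c ->
   lam ▷ e = idc e -> rho ▷ e = idc e ->
   ccod lam = idm C1 -> ccod rho = idm C1 ->
   mult_formula PB d c e lam rho m ->
   assoc_formula PB d c e lam rho α ->
   homogeneous_pseudocategory PB d c e m α lam rho).
Proof.
have wm : cells_weakly_maltsev (GA limA faithV presV p).
  exact: groupoid_cells_weakly_maltsev.
split=> [H|].
  have [pc [lam_e rho_e]] := H.
  have [de ce _ _ _ _ _ _ _ lam_cod _ _ rho_cod dlam drho clam crho _ _ _ _ _] := pc.
  have [units assoc] := pseudocategory_restrictions wm de ce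
    (vinv_inverse lam) (vinv_inverse rho) lam_cod rho_cod lam_e rho_e H.
  have hm := (mult_formulaP de ce m lam_e rho_e).2 units.
  have hα := (assoc_formulaP de ce α lam_e rho_e lam_cod).2 assoc.
  do 5![split; first by []]; split; (split; first by []) => x hx.
  - by apply: Vhom_inj; rewrite hm hx.
  - by apply: Vcell_inj; rewrite hα hx.
move=> de ce dlam drho clam crho lam_e rho_e lam_cod rho_cod hm hα.
apply: (pseudocategory_of_restrictions wm (vinv_inverse lam) (vinv_inverse rho)) => //.
- exact: groupoid_cell_invertible.
- exact: (mult_formulaP de ce m lam_e rho_e).1.
- exact: (assoc_formulaP de ce α lam_e rho_e lam_cod).1.
Qed.
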